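(* Let $L\ge 1$ be an integer and let $X=\sum_{j=1}^{L}|h_j|^2$, where $h_1,\dots,h_L$ are i.i.d. circularly symmetric complex Gaussian random variables with zero mean and unit variance ($\mathcal{CN}(0,1)$). Denote the distribution function of $X$ by $F_X(x)$. For each $n$, let $X_1,\dots,X_n$ be i.i.d. copies of $X$, and let $X_{i_1}\le X_{i_2}\le\cdots\le X_{i_n}$ be their nondecreasing rearrangement (order statistics). Define \[ a_n=\inf\left\{x:\;1-F_X(x)\le \tfrac{1}{n}\right\},\qquad b_n=\frac{\sum_{i=0}^{L-1}\frac{L-i}{i!}a_n^{i}}{\sum_{i=0}^{L-1}\frac{1}{i!}a_n^{i}}, \] and \[ \mu_1^{x}=\int_{-\infty}^{+\infty}x\,d\!\left(e^{-e^{-x}}\right)=0.577216\cdots . \] Then for any fixed positive integer $l$, \[ \lim_{n\to+\infty}\mathrm{E}\left[\frac{\sum_{k=1}^{l}X_{i_{n-k+1}}-l\,a_n}{b_n}\right]=l\left(\mu_1^{x}+1-\sum_{k=1}^{l}\frac{1}{k}\right). \]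
   Context: $\sum_{k=1}^{l}X_{i_{n-k+1}}$ is the sum of the $l$ largest among the $n$ i.i.d. random variables $X_1,\dots,X_n$. *)

(* Defs.v *)
From HB Require Import structures.
From mathcomp Require Import all_boot all_order all_algebra.
From mathcomp Require Import all_classical all_reals all_analysis.
From mathcomp Require Import normal_distribution.
Set Implicit Arguments. Unset Strict Implicit. Unset Printing Implicit Defensive.
Import Order.TTheory GRing.Theory Num.Theory.
Import numFieldNormedType.Exports.
Local Open Scope classical_set_scope.
Local Open Scope ring_scope.

Definition mutually_independent d (T : measurableType d) (R : realType)
    (P : probability T R) (I : eqType) (Y : I -> T -> R) : Prop :=
  (forall i, measurable_fun setT (Y i)) /\
  forall (J : seq I) (B : I -> set R), uniq J -> (forall i, measurable (B i)) ->
    P (\big[setI/setT]_(i <- J) (Y i @^-1` B i)) =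
    (\prod_(i <- J) P (Y i @^-1` B i))%E.

(* A real random variable with the normal distribution N(m, s^2)
   (s = standard deviation). *)
Definition is_normal d (T : measurableType d) (R : realType)
    (P : probability T R) (m s : R) (Y : T -> R) : Prop :=
  forall B : set R, measurable B -> P (Y @^-1` B) = normal_prob m s B.

Definition sum_largest (R : realType) (l : nat) (s : seq R) : R :=
  \sum_(x <- take l (sort (fun x y : R => y <= x) s)) x.

(* mu_1^x = \int x d(exp(-exp(-x))), the mean of the standard Gumbel law,
   written with the density d/dx exp(-exp(-x)) = exp(-x) exp(-exp(-x)). *)
Definition gumbel_mean (R : realType) : \bar R :=
  (\int[@lebesgue_measure R]_(x in [set: R])
      (x * (expR (- x) * expR (- expR (- x))))%:E)%E.

Definition a_seq (R : realType) (F : R -> R) (n : nat) : R :=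
  inf [set x : R | 1 - F x <= n%:R^-1].

Definition b_of (R : realType) (L : nat) (a : R) : R :=
  (\sum_(i < L) (L - i)%:R / (i`!)%:R * a ^+ i) /
  (\sum_(i < L) 1 / (i`!)%:R * a ^+ i).

(* Main.v *)
(* Idea. By the layer-cake formula the sum of the l largest of n nonnegative numbers is
   \int_0^oo min(l, #{m : t <= X_m}) dt.  The count is binomial(n, p(t)), where p is the Erlang
   tail p(t) = exp(-t) \sum_(i < L) t^i / i!, so the expected integrand is an explicit function
   of p(t).  After t = a_n + b_n u one has b_n -> 1 and n p(t) -> exp(-u), so the counts become
   Poisson(exp(-u)).  The integrand, minus l on t <= a_n, is dominated by a multiple of
   exp(-|u| / 2), and its limit is a combination of the derivatives of
   exp(-exp(-u)) \sum_(j <= k) exp(-j u) / j!, each of integral 1, and of 1{u > 0} - exp(-exp(-u)),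
   whose integral is the Gumbel mean.
   The Erlang tail is itself obtained by layer-cake: the squared modulus of a complex Gaussian
   is exponential since the measure of planar discs is proportional to the squared radius, and
   each further exponential summand adds one term to the sum. *)

Require Import Defs.
From HB Require Import structures.
From mathcomp Require Import all_boot all_order all_algebra.
From mathcomp Require Import all_classical all_reals all_analysis.
From mathcomp Require Import normal_distribution.
From mathcomp Require Import measurable_realfun ring lra.
Set Implicit Arguments.
Unset Strict Implicit.
Unset Printing Implicit Defensive.
Import Order.TTheory GRing.Theory Num.Theory.
Import numFieldNormedType.Exports.
Local Open Scope classical_set_scope.
Local Open Scope ring_scope.

(** * Erlang tails *)

(** Convergence in law of the order statistics would not give convergence of their means, which is
    why the problem is reduced to a deterministic integral over the level. The domination rests on
    submultiplicativity of the tail, p(s + t) <= p(s) p(t). As p(a_n) = 1/n, it bounds n p(a_n + b_n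
    u) above by p(b_n u) for u > 0, and below by 1 / p(-b_n u) for u <= 0 while the level a_n + b_n
    u is positive; in the second case E[(l - B)^+], with B the count, is at most a constant over n
    p. The polynomial factor of p is absorbed by giving up half of the exponential rate, whence
    exp(-|u| / 2). The number b_n is the mean excess of X over a_n, that is the integral of p beyond
    a_n divided by p(a_n); it enters through 1 <= b_n <= 1 + L^2 / a_n. The harmonic sum comes from
    the weights (m - k) / (k + 1), k < m = l - 1, carried by the densities of integral 1. *)

Definition expsum (R : realType) (k : nat) (x : R) : R :=
  \sum_(i < k) x ^+ i / i`!%:R.

Definition erlang_tail (R : realType) (k : nat) (x : R) : R :=
  expR (- x) * expsum k x.

Section expsum.
Variable R : realType.
Implicit Types (x s v : R) (k : nat).

Lemma fact_gt0R k : 0 < k`!%:R :> R.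
Proof. by rewrite ltr0n fact_gt0. Qed.

Lemma expsumS k x : expsum k.+1 x = expsum k x + x ^+ k / k`!%:R.
Proof. by rewrite /expsum big_ord_recr. Qed.

Lemma expsum_ge0 k x : 0 <= x -> 0 <= expsum k x.
Proof.
by move=> x0; apply: sumr_ge0 => i _; rewrite divr_ge0 ?exprn_ge0 ?ler0n.
Qed.

Lemma expsum_ge1 k x : (0 < k)%N -> 0 <= x -> 1 <= expsum k x.
Proof.
case: k => // k _ x0; rewrite /expsum big_ord_recl expr0 fact0 divr1 lerDl.
by apply: sumr_ge0 => i _; rewrite divr_ge0 ?exprn_ge0 ?ler0n.
Qed.

Lemma expsum_le_expR k x : 0 <= x -> expsum k x <= expR x.
Proof.
move=> x0; have -> : expsum k x = series (exp_coeff x) k.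
  by rewrite /expsum /series /= big_mkord.
apply: nondecreasing_cvgn_le; last exact: is_cvg_series_exp_coeff.
apply/nondecreasing_seqP => n; rewrite /series /= big_nat_recr //= lerDl.
exact: exp_coeff_ge0.
Qed.

Lemma expsum_lt_expR k x : 0 < x -> expsum k x < expR x.
Proof.
move=> x0; apply: (lt_le_trans _ (expsum_le_expR k.+1 (ltW x0))).
by rewrite expsumS ltrDl divr_gt0 ?exprn_gt0 ?fact_gt0R.
Qed.

Lemma exprn_le_expR k x : 0 <= x -> x ^+ k <= k`!%:R * expR x.
Proof.
move=> x0; rewrite mulrC -ler_pdivrMr ?fact_gt0R//.
apply: (le_trans _ (expsum_le_expR k.+1 x0)).
by rewrite expsumS lerDr expsum_ge0.
Qed.

(** The binomial theorem leaves the products of s^i / i! and v^j / j! with i + j < k, a part of the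
    square i, j < k, and all of them are nonnegative. *)
Lemma expsumD_le k s v : 0 <= s -> 0 <= v ->
  expsum k (s + v) <= expsum k s * expsum k v.
Proof.
move=> s0 v0; rewrite /expsum big_distrlr/=.
pose t (i j : nat) : R := s ^+ i / i`!%:R * (v ^+ j / j`!%:R).
have t0 i j : 0 <= t i j by rewrite !mulr_ge0 ?exprn_ge0 ?invr_ge0 ?ler0n.
have -> : \sum_(i < k) (s + v) ^+ i / i`!%:R =
    \sum_(i < k) \sum_(j < k | (j <= i)%N) t j (i - j)%N.
  apply: eq_bigr => i _; rewrite addrC exprDn mulr_suml.
  rewrite (big_ord_widen k
    (fun j : nat => (v ^+ (i - j) * s ^+ j *+ 'C(i, j)) / i`!%:R)) //=.
  apply: eq_bigr => j; rewrite ltnS => ji.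
  rewrite /t -(bin_fact ji) !natrM -mulr_natr.
  have h1 := fact_gt0R j; have h2 := fact_gt0R (i - j)%N.
  have h3 : 0 < 'C(i, j)%:R :> R by rewrite ltr0n bin_gt0.
  by field; rewrite !gt_eqF.
rewrite (exchange_big_dep xpredT)//=.
apply: ler_sum => j _.
rewrite -(big_mkord (fun i => (j <= i)%N) (fun i => t j (i - j)%N)).
rewrite -(big_mkord xpredT (fun i => t j i)).
rewrite (@big_cat_nat _ _ _ j 0 k)//= ?(ltnW (ltn_ord j))// big_nat_cond.
rewrite big_pred0 ?add0r; last by move=> i; rewrite ltnNge; case: (j <= i)%N; rewrite ?andbF.
rewrite -{1}(add0n (j : nat)) big_addn (@big_cat_nat _ _ _ (k - j) 0 k)//= ?leq_subr//.
rewrite [leLHS](_ : _ = \sum_(0 <= i < k - j) t j i); last first.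
  by apply: eq_big => [i|i _]; rewrite ?leq_addl// addnK.
by rewrite lerDl sumr_ge0.
Qed.

(** Writing v^i = 2^i (v/2)^i with 2^i <= 2^k trades polynomial growth for half of the exponential
    rate. *)
Lemma expsum_le_half k v : 0 <= v -> expsum k v <= 2 ^+ k * expR (v / 2).
Proof.
move=> v0; have v20 : 0 <= v / 2 by rewrite divr_ge0.
apply: (@le_trans _ _ (2 ^+ k * expsum k (v / 2))); last first.
  by rewrite ler_wpM2l ?exprn_ge0 ?expsum_le_expR.
rewrite /expsum mulr_sumr; apply: ler_sum => i _.
rewrite -[in leLHS](@mulfVK _ 2 _ v)// exprMn [_ * 2 ^+ i]mulrC -mulrA.
by rewrite ler_wpM2r ?divr_ge0 ?exprn_ge0 ?ler0n// ler_weXn2l ?ler1n// ltnW.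
Qed.

Lemma erlang_tail_ge0 k x : 0 <= x -> 0 <= erlang_tail k x.
Proof. by move=> x0; rewrite mulr_ge0 ?expR_ge0 ?expsum_ge0. Qed.

Lemma erlang_tail_gt0 k x : (0 < k)%N -> 0 <= x -> 0 < erlang_tail k x.
Proof.
move=> k0 x0; rewrite mulr_gt0 ?expR_gt0//.
by rewrite (lt_le_trans ltr01) ?expsum_ge1.
Qed.

Lemma erlang_tail_at0 k : (0 < k)%N -> erlang_tail k 0 = 1 :> R.
Proof.
case: k => // k _; rewrite /erlang_tail oppr0 expR0 mul1r /expsum big_ord_recl.
rewrite expr0 fact0 divr1 big1 ?addr0// => i _.
by rewrite expr0n mul0r.
Qed.

(** The exponential factor is multiplicative, so [expsumD_le] decides. Strict monotonicity of the
    tail and both halves of the domination follow from this inequality. *)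
Lemma erlang_tailD_le k s v : 0 <= s -> 0 <= v ->
  erlang_tail k (s + v) <= erlang_tail k s * erlang_tail k v.
Proof.
move=> s0 v0; rewrite /erlang_tail opprD expRD mulrACA.
by rewrite ler_wpM2l ?mulr_ge0 ?expR_ge0// expsumD_le.
Qed.

Lemma erlang_tail_le_half k v : 0 <= v ->
  erlang_tail k v <= 2 ^+ k * expR (- (v / 2)).
Proof.
move=> v0; rewrite /erlang_tail.
have -> : expR (- (v / 2)) = expR (- v) * expR (v / 2).
  by rewrite -expRD; congr expR; field.
by rewrite mulrCA ler_wpM2l ?expR_ge0 ?expsum_le_half.
Qed.

Lemma erlang_tail_lt1 k v : 0 < v -> erlang_tail k v < 1.
Proof.
by move=> v0; rewrite /erlang_tail expRN mulrC ltr_pdivrMr ?expR_gt0 ?mul1r ?expsum_lt_expR.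
Qed.

Lemma erlang_tail_decr k s t : (0 < k)%N -> 0 <= s -> s < t ->
  erlang_tail k t < erlang_tail k s.
Proof.
move=> k0 s0 st; have ts : 0 < t - s by rewrite subr_gt0.
have := erlang_tailD_le k s0 (ltW ts); rewrite addrC subrK => /le_lt_trans; apply.
by rewrite gtr_pMr ?erlang_tail_lt1 ?erlang_tail_gt0.
Qed.

(** Termwise, x^(i+1) / i! = (i+1) x^(i+1) / (i+1)! and i + 1 <= k. This is what makes [b_of L x]
    differ from 1 by O(1/x). *)
Lemma expsum_ratio k x : 0 <= x -> x * expsum k x <= k%:R * expsum k.+1 x.
Proof.
move=> x0; rewrite /expsum big_ord_recl mulr_sumr mulrDr.
rewrite -[leLHS]add0r lerD// ?mulr_ge0 ?invr_ge0//.
rewrite mulr_sumr; apply: ler_sum => i _; rewrite lift0 factS natrM exprS.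
have h1 := fact_gt0R i.
rewrite [leLHS](_ : _ = i.+1%:R * (x * x ^+ i / (i.+1%:R * i`!%:R))); last first.
  have : i.+1%:R != 0 :> R by rewrite pnatr_eq0.
  by move: (i.+1%:R) => c c0; field; rewrite gt_eqF.
by rewrite ler_wpM2r ?ler_nat// divr_ge0 ?mulr_ge0 ?exprn_ge0// ltW.
Qed.

Lemma is_derive_expsum k x : is_derive x 1 (@expsum R k.+1) (expsum k x).
Proof.
elim: k => [|k IH].
  rewrite (_ : expsum 1 = cst 1); last first.
    by apply/funext => y; rewrite /expsum big_ord1 expr0 fact0 divr1.
  by rewrite /expsum big_ord0; exact: is_derive_cst.
rewrite (_ : expsum k.+2 = expsum k.+1 \+ ((k.+1`!%:R)^-1 *: (@id R) ^+ k.+1)); last first.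
  by apply/funext => y; rewrite expsumS /= !fctE [X in _ + X]mulrC.
rewrite expsumS; apply: is_deriveD.
apply: is_derive_eq.
rewrite /GRing.scale /= mulr1 factS natrM.
have h1 := fact_gt0R k.
have : k.+1%:R != 0 :> R by rewrite pnatr_eq0.
by move: (k.+1%:R) => c c0; field; rewrite gt_eqF.
Qed.

Lemma continuous_expsum k : continuous (@expsum R k).
Proof.
case: k => [|k x].
  rewrite (_ : expsum 0 = cst 0); first exact: cst_continuous.
  by apply/funext => y; rewrite /expsum big_ord0.
apply: differentiable_continuous; apply/derivable1_diffP.
by have [] := is_derive_expsum k x.
Qed.

Lemma continuous_erlang_tail k : continuous (@erlang_tail R k).
Proof.
move=> x; apply: cvgM; last exact: continuous_expsum.
by apply: continuous_comp; [exact: opp_continuous|exact: continuous_expR].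
Qed.

(** The derivative telescopes, since [expsum k x - expsum k.+1 x] is a single monomial; minus the
    Gamma density remains. *)
Lemma is_derive_erlang_tail k x :
  is_derive x 1 (@erlang_tail R k.+1) (- (expR (- x) * (x ^+ k / k`!%:R))).
Proof.
have h1 := is_derive_expsum k x.
rewrite /erlang_tail (_ : (fun _ => _) = (expR \o -%R) * expsum k.+1)//.
apply: is_derive_eq.
rewrite expsumS /= /GRing.scale /=.
by ring.
Qed.

End expsum.

(** * Independence of functions of disjoint blocks *)

Section independence.
Context d (T : measurableType d) (R : realType) (P : probability T R).
Variables (I : choiceType) (Y : I -> T -> R).
Hypothesis indY : mutually_independent P Y.

(** Finite-dimensional events on the coordinates in [J]: a pi-system generating the sigma-algebra of
    the block, on which independence is read off the hypothesis. *)
Definition cylinder (J : pred I) : set (set T) :=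
  [set A | exists s : seq I, exists B : I -> set R,
    [/\ uniq s, {subset s <= J}, (forall i, measurable (B i)) &
        A = \big[setI/setT]_(i <- s) (Y i @^-1` B i)]].

Lemma cylinder_measurable J : cylinder J `<=` measurable.
Proof.
have [mY _] := indY.
move=> _ [s [B [_ _ mB ->]]]; apply: bigsetI_measurable => i _.
by rewrite -[X in measurable X]setTI; exact: mY.
Qed.

Lemma cylinderT J : cylinder J setT.
Proof.
by exists [::], (fun=> setT); split => //; rewrite big_nil.
Qed.

Lemma cylinder_preimage J i B : i \in J -> measurable B ->
  cylinder J (Y i @^-1` B).
Proof.
move=> iJ mB; exists [:: i], (fun=> B); split => //; last by rewrite big_seq1.
by move=> j; rewrite inE => /eqP->.
Qed.

Lemma cylinder_setI J : setI_closed (cylinder J).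
Proof.
move=> _ _ [s [B [us sJ mB ->]]] [s' [B' [us' sJ' mB' ->]]].
(* The index lists are merged; a coordinate absent from one list carries the constraint [setT]
   there. *)
exists (undup (s ++ s')), (fun i => (if i \in s then B i else setT) `&`
                                   (if i \in s' then B' i else setT)).
split; first exact: undup_uniq.
- by move=> i; rewrite mem_undup mem_cat => /orP[/sJ|/sJ'].
- by move=> i; apply: measurableI; case: ifP.
rewrite -!bigcap_seq; apply/seteqP; split => [w [h1 h2] i /=|w h].
  rewrite mem_undup mem_cat => iss.
  by split; case: ifPn => // ?; [exact: h1|exact: h2].
split => i /= iss.
  have /(_ _)[|]/= := h i; first by rewrite /= mem_undup mem_cat iss.
  by rewrite iss.
have /(_ _)[|]/= := h i; first by rewrite /= mem_undup mem_cat iss orbT.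
by rewrite iss.
Qed.

Lemma cylinder_indep J J' A A' : {in J, forall i, i \notin J'} ->
  cylinder J A -> cylinder J' A' -> P (A `&` A') = (P A * P A')%E.
Proof.
move=> dJ [s [B [us sJ mB ->]]] [s' [B' [us' sJ' mB' ->]]].
have ss' i : i \in s' -> i \notin s.
  by move=> /sJ' is'; apply/negP => /sJ /dJ; rewrite is'.
(* Disjointness lets a single family carry both constraints, so that independence over [s ++ s']
   applies. *)
pose C i := if i \in s then B i else B' i.
have mC i : measurable (C i) by rewrite /C; case: ifP.
have -> : \big[setI/setT]_(i <- s) Y i @^-1` B i =
          \big[setI/setT]_(i <- s) Y i @^-1` C i.
  by apply: eq_big_seq => i si; rewrite /C si.
have -> : \big[setI/setT]_(i <- s') Y i @^-1` B' i =
          \big[setI/setT]_(i <- s') Y i @^-1` C i.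
  by apply: eq_big_seq => i si; rewrite /C (negbTE (ss' _ si)).
have [_ h] := indY.
rewrite -big_cat !h//= ?big_cat//.
rewrite cat_uniq us us' andbT; apply/hasPn => i; exact: ss'.
Qed.

(** Dynkin's argument: B |-> P(B cap A) and B |-> P(B) P(A) are finite measures that agree on the
    pi-system [G]. *)
Let mrestr_eq (A : set T) (mA : measurable A) (G : set (set T)) :
  G `<=` measurable -> setI_closed G -> G setT ->
  (forall B, G B -> P (B `&` A) = (P B * P A)%E) ->
  forall B, <<s G >> B -> P (B `&` A) = (P B * P A)%E.
Proof.
move=> Gm GI GT h B sB.
have PA0 : 0 <= fine (P A) by rewrite fine_ge0.
have PAE : P A = (fine (P A))%:E by rewrite fineK// fin_num_measure.
have -> : (P B * P A)%E = mscale (NngNum PA0) P B.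
  by rewrite /mscale/= muleC -PAE.
have -> : P (B `&` A) = mrestr P mA B by [].
apply: (g_sigma_algebra_measure_unique G Gm (fun=> setT)) => //.
- by rewrite bigcup_const.
- by move=> C GC; rewrite /= /mrestr h// /mscale/= muleC -PAE.
- by move=> _; rewrite /= /mrestr setTI PAE ltry.
Qed.

Lemma sigma_measurable J A : <<s cylinder J >> A -> measurable A.
Proof.
apply: smallest_sub; first exact: sigma_algebra_measurable.
exact: cylinder_measurable.
Qed.

(** The uniqueness argument is used once per side: against a fixed cylinder of [J] the cylinders of
    [J'] are extended, then the cylinders of [J] against a fixed event of the other block. *)
Lemma sigma_indep J J' A A' : {in J, forall i, i \notin J'} ->
  <<s cylinder J >> A -> <<s cylinder J' >> A' ->
  P (A `&` A') = (P A * P A')%E.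
Proof.
move=> dJ sA sA'.
apply: (mrestr_eq (sigma_measurable sA') (@cylinder_measurable J)) sA.
- exact: cylinder_setI.
- exact: cylinderT.
move=> B cB; rewrite setIC muleC.
have mB := cylinder_measurable cB.
apply: (mrestr_eq mB (@cylinder_measurable J')) sA'.
- exact: cylinder_setI.
- exact: cylinderT.
by move=> C cC; rewrite setIC muleC (cylinder_indep dJ).
Qed.

(** Phrased with [measurable_fun] over the generated sigma-algebra, so that the closure lemmas for
    sums and powers apply to functions of a block. *)
Definition sigma_fun (J : pred I) (f : T -> R) :=
  measurable_fun [set: g_sigma_algebraType (cylinder J)]
    (f : g_sigma_algebraType (cylinder J) -> R).

Lemma sigma_fun_coord J i : i \in J -> sigma_fun J (Y i).
Proof.
move=> iJ _ B mB; rewrite setTI; apply: sub_sigma_algebra.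
exact: cylinder_preimage.
Qed.

Lemma sigma_fun_preimage J f B : sigma_fun J f -> measurable B ->
  <<s cylinder J >> (f @^-1` B).
Proof. by move=> sf mB; have := sf measurableT B mB; rewrite setTI. Qed.

Lemma sigma_fun_measurable J f : sigma_fun J f -> measurable_fun setT f.
Proof.
move=> sf _ B mB; rewrite setTI; apply: (@sigma_measurable J).
exact: sigma_fun_preimage.
Qed.

Lemma cylinder_sub (J J' : pred I) : {subset J <= J'} ->
  cylinder J `<=` cylinder J'.
Proof.
by move=> JJ' _ [s [B [us sJ mB ->]]]; exists s, B; split => // i /sJ /JJ'.
Qed.

Lemma sigma_fun_sub (J J' : pred I) f : {subset J <= J'} ->
  sigma_fun J f -> sigma_fun J' f.
Proof.
move=> JJ' sf _ B mB; rewrite setTI.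
by apply: (sub_smallest2r (@smallest_sigma_algebra _ setT _) (cylinder_sub JJ'));
  exact: sigma_fun_preimage.
Qed.

Lemma sigma_fun_indep J J' f g B C : {in J, forall i, i \notin J'} ->
  sigma_fun J f -> sigma_fun J' g -> measurable B -> measurable C ->
  P (f @^-1` B `&` g @^-1` C) = (P (f @^-1` B) * P (g @^-1` C))%E.
Proof. by move=> dJ sf sg mB mC; apply: sigma_indep dJ _ _; exact: sigma_fun_preimage. Qed.

Lemma mutually_independent_blocks (K : eqType) (J : K -> pred I) (X : K -> T -> R) :
  (forall k k', k != k' -> {in J k, forall i, i \notin J k'}) ->
  (forall k, sigma_fun (J k) (X k)) -> mutually_independent P X.
Proof.
move=> dJ sX; split => [k|s B us mB]; first exact: sigma_fun_measurable (sX k).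
(* Union of the remaining blocks: the rest of the intersection lies in its sigma-algebra, which is
   independent of the block peeled off. *)
pose U (s : seq K) : pred I := fun i => has (fun k => i \in J k) s.
have sU r : <<s cylinder (U r) >> (\big[setI/setT]_(k <- r) X k @^-1` B k).
  rewrite big_seq; apply: (@bigsetI_measurable _ (g_sigma_algebraType (cylinder (U r)))) => k kr.
  apply: sigma_fun_preimage (mB k); apply: sigma_fun_sub (sX k) => i iJ.
  by apply/hasP; exists k.
elim: s us => [_|k s IH /= /andP[ks us]]; first by rewrite !big_nil probability_setT.
rewrite !big_cons -IH//; apply: (@sigma_indep (J k) (U s)) => //.
- move=> i iJ; apply/hasPn => k' k's; apply: (dJ k k') => //.
  by apply: contraNneq ks => ->.
- exact: sigma_fun_preimage (mB k).
Qed.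

End independence.

(** * Joint laws, affine substitution and layer-cake by Tonelli *)

Section joint_law.
Local Open Scope ereal_scope.
Context d (T : measurableType d) (R : realType) (P : probability T R).
Context d1 d2 (T1 : measurableType d1) (T2 : measurableType d2).
Variables (X : {mfun T >-> T1}) (Y : {mfun T >-> T2}).
Hypothesis indXY : forall B C, measurable B -> measurable C ->
  P (X @^-1` B `&` Y @^-1` C) = P (X @^-1` B) * P (Y @^-1` C).

Let XY w := (X w, Y w).

Let mXY : measurable_fun setT XY.
Proof. exact: measurable_fun_pair. Qed.

Let mXY_mixin := isMeasurableFun.Build _ _ _ _ _ mXY.
Let XYm : {mfun T >-> (T1 * T2)%type} := HB.pack XY mXY_mixin.

(** On rectangles the joint law is the product of the marginals, hence everywhere by uniqueness of
    the product measure; Tonelli then gives the iterated integral. *)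
Lemma integral_indep (h : T1 * T2 -> \bar R) :
  measurable_fun setT h -> (forall z, 0 <= h z) ->
  \int[P]_w h (X w, Y w) =
  \int[distribution P X]_x \int[distribution P Y]_y h (x, y).
Proof.
move=> mh h0.
rewrite -(fubini_tonelli1 h)//.
transitivity (\int[distribution P XYm]_z h z).
  by rewrite ge0_integral_distribution.
apply: eq_measure_integral => A mA _; apply/esym.
exact: product_measure_unique.
Qed.

End joint_law.

Section lebesgue_affine.
Local Open Scope ereal_scope.
Variable R : realType.
Notation mu := (@lebesgue_measure R).

(** The image of Lebesgue measure under x |-> a + b x, scaled by b, gives intervals their length, so
    it is Lebesgue measure. *)
Lemma ge0_integral_affine (a b : R) (f : R -> \bar R) : (0 < b)%R ->
  measurable_fun setT f -> (forall x, 0 <= f x) ->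
  \int[mu]_x f x = b%:E * \int[mu]_x f (a + b * x)%R.
Proof.
move=> b0 mf f0.
pose phi : measurableTypeR R -> measurableTypeR R := fun x => (a + b * x)%R.
have mphi : measurable_fun setT phi.
  by apply: measurable_funD => //; apply: measurable_funM.
pose nu := mscale (NngNum (ltW b0)) (pushforward mu phi).
have muE A : measurable A -> mu A = nu mphi A.
  apply: lebesgue_measure_unique => _ [[x y]] _ <-.
  transitivity (b%:E * mu (phi @^-1` `]x, y]%classic)); last by [].
  have -> : phi @^-1` `]x, y]%classic = `]((x - a) / b)%R, ((y - a) / b)%R]%classic.
    apply/seteqP; split => z; rewrite /phi /= !in_itv/= ltr_pdivrMr// ler_pdivlMr//.
      by rewrite ltrBlDl lerBrDl mulrC.
    by rewrite ltrBlDl lerBrDl mulrC.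
  rewrite !lebesgue_measure_itv/= !lte_fin ltr_pM2r ?invr_gt0// ltrD2r.
  case: ifPn => xy; last by rewrite mule0.
  by rewrite -!EFinD -EFinM; congr EFin; field; rewrite gt_eqF.
rewrite (eq_measure_integral (nu mphi)); last by move=> A mA _; exact: muE.
rewrite ge0_integral_mscale//=; congr (_ * _).
by rewrite ge0_integral_pushforward.
Qed.

End lebesgue_affine.

Section layer.
Local Open Scope ereal_scope.
Context d (T : measurableType d) (R : realType).
Variable m : {sigma_finite_measure set T -> \bar R}.
Notation mu := (@lebesgue_measure R).

(** When the slices of [A] are the levels on one side of a function of [x], the inner integral on
    the left is an integral of [h] up to or from that function, and the right side involves only its
    distribution. *)
Lemma integral_layer (A : set (T * measurableTypeR R)) (h : R -> R) :
  measurable A -> measurable_fun setT h -> (forall v, 0 <= h v)%R ->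
  \int[m]_x \int[mu]_v (\1_A (x, v) * h v)%:E =
  \int[mu]_v ((h v)%:E * m [set x | A (x, v)]).
Proof.
move=> mA mh h0.
have mf : measurable_fun setT (fun z : T * measurableTypeR R => (\1_A z * h z.2)%:E).
  apply/measurable_EFinP; apply: measurable_funM => //.
  exact: measurableT_comp.
rewrite (@fubini_tonelli _ _ _ _ _ m mu (fun z => (\1_A z * h z.2)%:E))//=; last first.
  by move=> z; rewrite lee_fin mulr_ge0.
apply: eq_integral => v _.
have mAv : measurable [set x | A (x, v)].
  by have := measurable_ysection v mA; rewrite ysectionE.
under eq_integral do rewrite mulrC EFinM.
rewrite ge0_integralZl//=; last 2 first.
- apply/measurable_EFinP.
  rewrite (_ : (fun _ => _) = \1_[set x | A (x, v)]) //.
- by rewrite lee_fin.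
congr (_ * _).
by have := integral_indic m measurableT mAv; rewrite setIT => <-.
Qed.

End layer.

(** * The law of the squared modulus of a complex Gaussian *)

Section density.
Local Open Scope ereal_scope.
Context d (T : measurableType d) (R : realType).

Lemma measurable_set_ler (f g : T -> R) :
  measurable_fun setT f -> measurable_fun setT g ->
  measurable [set x | (f x <= g x)%R].
Proof.
move=> mf mg; rewrite -[X in measurable X]setTI.
exact: (measurable_fun_ler mf mg measurableT (Y := [set true])).
Qed.

Lemma measurable_set_ltr (f g : T -> R) :
  measurable_fun setT f -> measurable_fun setT g ->
  measurable [set x | (f x < g x)%R].
Proof.
move=> mf mg; rewrite -[X in measurable X]setTI.
exact: (measurable_fun_ltr mf mg measurableT (Y := [set true])).
Qed.

Lemma integral_indicT (m : {measure set T -> \bar R}) (A : set T) :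
  measurable A -> \int[m]_x (\1_A x)%:E = m A.
Proof. by move=> mA; rewrite integral_indic// setIT. Qed.

Lemma indic_setE (b : T -> bool) (x : T) : \1_[set y | b y] x = (b x)%:R :> R.
Proof. by rewrite indicE; congr ((_ : bool)%:R); exact: asboolb. Qed.

Variables (nu : {finite_measure set T -> \bar R})
          (mu : {sigma_finite_measure set T -> \bar R}) (g : T -> R).
Hypotheses (mg : measurable_fun setT g) (g0 : forall x, (0 <= g x)%R).
Hypothesis nuE : forall A, measurable A -> nu A = \int[mu]_(x in A) (g x)%:E.

(** By [nuE], [g] is almost everywhere the Radon-Nikodym derivative, for which the change of measure
    is known. *)
Lemma ge0_integral_density (f : T -> \bar R) :
  measurable_fun setT f -> (forall x, 0 <= f x) ->
  \int[nu]_x f x = \int[mu]_x (f x * (g x)%:E).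
Proof.
move=> mf f0.
have mEg : measurable_fun setT (EFin \o g) by exact/measurable_EFinP.
have dom : nu `<< mu.
  apply/null_content_dominatesP => A mA A0; rewrite nuE//.
  by apply: null_set_integral => //; exact: measurable_funTS.
rewrite -(Radon_Nikodym_SigmaFinite.change_of_variables dom)//.
apply: ae_eq_integral => //.
- apply: emeasurable_funM => //.
  exact: measurable_int (Radon_Nikodym_SigmaFinite.f_integrable dom).
- exact: emeasurable_funM.
apply: ae_eqe_mul2l; apply: integral_ae_eq => //.
  exact: Radon_Nikodym_SigmaFinite.f_integrable.
by move=> E _ mE; rewrite -Radon_Nikodym_SigmaFinite.f_integral// nuE.
Qed.

End density.

Section disc.
Local Open Scope ereal_scope.
Variable R : realType.
Notation mu := (@lebesgue_measure R).
Notation mR := (measurableTypeR R).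

Definition disc (v : R) : set (mR * mR) :=
  [set z | ((z.1 : R) ^+ 2 + (z.2 : R) ^+ 2 < v)%R].

Definition disc_area (v : R) : \bar R :=
  \int[mu]_x \int[mu]_y (\1_(disc v) (x, y))%:E.

Lemma measurable_sqsum : measurable_fun setT
  (fun z : mR * mR => (z.1 : R) ^+ 2 + (z.2 : R) ^+ 2)%R.
Proof.
apply: measurable_funD; apply: measurable_funX.
  exact: measurable_fst.
exact: measurable_snd.
Qed.

Lemma measurable_disc v : measurable (disc v).
Proof. by apply: measurable_set_ltr => //; exact: measurable_sqsum. Qed.

Lemma measurable_indic_disc v :
  measurable_fun setT (fun z => (\1_(disc v) z)%:E : \bar R).
Proof.
by apply/measurable_EFinP; apply: measurable_indic; exact: measurable_disc.
Qed.

Let measurable_disc_section v :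
  measurable_fun setT (fun x : R => \int[mu]_y (\1_(disc v) (x, y))%:E).
Proof.
apply: (measurable_fun_fubini_tonelli_F (m2 := mu) (fun z => (\1_(disc v) z)%:E)
  (measurable_indic_disc v)).
by move=> z; rewrite lee_fin.
Qed.

Lemma indic_disc_scale v x y : (0 < v)%R ->
  \1_(disc v) (0 + Num.sqrt v * x, 0 + Num.sqrt v * y)%R =
  \1_(disc 1) (x, y) :> R.
Proof.
move=> v0; rewrite !indicE; congr ((_ : bool)%:R).
apply: asbool_equiv_eq; rewrite /disc /=.
rewrite !add0r !exprMn sqr_sqrtr ?ltW// -mulrDr.
by rewrite -[X in (_ < X)%R <-> _]mulr1 ltr_pM2l.
Qed.

(** Rescaling each coordinate by sqrt(v) contributes one factor sqrt(v) per integral. *)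
Lemma disc_area_scale v : (0 < v)%R -> disc_area v = v%:E * disc_area 1.
Proof.
move=> v0; have s0 : (0 < Num.sqrt v)%R by rewrite sqrtr_gt0.
pose F (w x : R) : \bar R := \int[mu]_y (\1_(disc w) (x, y))%:E.
have F0 w x : 0 <= F w x by apply: integral_ge0 => y _; rewrite lee_fin.
have inner x : F v (0 + Num.sqrt v * x)%R = (Num.sqrt v)%:E * F 1%R x.
  rewrite /F.
  rewrite (ge0_integral_affine (f := fun y => (\1_(disc v) (0 + Num.sqrt v * x, y)%R)%:E) 0 s0).
  - congr (_ * _); apply: eq_integral => y _; congr (_%:E).
    exact: indic_disc_scale.
  - apply: (measurableT_comp (measurable_indic_disc v)).
    exact: (@measurable_pair1 _ _ mR mR).
  - by move=> y; rewrite lee_fin.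
transitivity (\int[mu]_x F v x); first by [].
rewrite (ge0_integral_affine 0 s0 (measurable_disc_section v) (F0 v)).
transitivity ((Num.sqrt v)%:E * \int[mu]_x ((Num.sqrt v)%:E * F 1%R x)).
  by congr (_ * _); apply: eq_integral => x _; exact: inner.
rewrite (ge0_integralZl mu measurableT (measurable_disc_section 1%R)); last 2 first.
- by move=> x _; exact: F0.
- by rewrite lee_fin ltW.
by rewrite muleA -EFinM -expr2 sqr_sqrtr// ltW.
Qed.

Lemma integral_itvoc_is_derive (f F : R -> R) (a b : R) : (a <= b)%R ->
  continuous f -> (forall x, is_derive x (1%R : R) F (f x)) ->
  \int[mu]_(x in `]a, b]) (f x)%:E = (F b - F a)%:E.
Proof.
rewrite le_eqVlt => /predU1P[->|ab] cf dF.
  by rewrite set_itvoc0 integral_set0 subrr.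
have cF : continuous F.
  move=> x; apply: differentiable_continuous; apply/derivable1_diffP.
  by have [] := dF x.
rewrite integral_itv_obnd_cbnd; last first.
  apply: measurable_funTS; apply/measurable_EFinP.
  exact: continuous_measurable_fun cf.
rewrite (@continuous_FTC2 _ _ F)//.
- exact: continuous_subspaceT cf.
- split.
  + by move=> x _; case: (dF x).
  + by apply: cvg_at_right_filter; exact: cF.
  + by apply: cvg_at_left_filter; exact: cF.
- by move=> x _; rewrite derive1E; exact: derive_val.
Qed.

Lemma is_derive_expRN (x : R) : is_derive x (1%R : R) (expR \o -%R) (- expR (- x))%R.
Proof.
apply: is_derive_eq; rewrite /GRing.scale /=; ring.
Qed.

Lemma continuous_expRN : continuous (fun x : R => expR (- x)).
Proof.
by move=> x; apply: continuous_comp; [exact: opp_continuous|exact: continuous_expR].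
Qed.

Lemma integral_itv_expRN (s r : R) : (s <= r)%R ->
  \int[mu]_(v in `]s, r]) (expR (- v))%:E = (expR (- s) - expR (- r))%:E.
Proof.
move=> sr.
have dF (x : R) : is_derive x (1%R : R) (- (expR \o -%R))%R (expR (- x)).
  by have h := is_deriveN (is_derive_expRN x); rewrite opprK in h.
by rewrite (integral_itvoc_is_derive sr continuous_expRN dF) /= opprK addrC.
Qed.

Lemma integral_itv_id_expRN (r : R) : (0 < r)%R ->
  \int[mu]_(v in `]0%R, r]) (expR (- v) * v)%:E =
  (1 - expR (- r) * (1 + r))%:E.
Proof.
move=> r0.
have E (y : R) : erlang_tail 2 y = (expR (- y) * (1 + y))%R.
  by rewrite /erlang_tail !expsumS /expsum big_ord0 expr0 expr1 fact0 !divr1 add0r.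
have cf : continuous (fun v : R => expR (- v) * v)%R.
  by move=> x; apply: cvgM; [exact: continuous_expRN|exact: cvg_id].
have dF (x : R) : is_derive x (1%R : R) (- @erlang_tail R 2)%R (expR (- x) * x)%R.
  have h := is_deriveN (is_derive_erlang_tail 1 x).
  by apply: is_derive_eq; rewrite opprK expr1 divr1.
rewrite (integral_itvoc_is_derive (ltW r0) cf dF) /= opprK addrC.
change ((erlang_tail 2 0 - erlang_tail 2 r)%:E = (1 - expR (- r) * (1 + r))%:E).
by rewrite !E oppr0 expR0 addr0 mulr1.
Qed.

Lemma integral_itv_expsum k (r : R) : (0 < r)%R ->
  \int[mu]_(v in `]0%R, r]) (expsum k v)%:E = (expsum k.+1 r - 1)%:E.
Proof.
move=> r0.
rewrite (integral_itvoc_is_derive (ltW r0) (@continuous_expsum R k) (@is_derive_expsum R k)).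
have := @erlang_tail_at0 R k.+1 isT.
by rewrite /erlang_tail oppr0 expR0 mul1r => ->.
Qed.

Lemma integral_itv_expR (s r : R) : (s <= r)%R ->
  \int[mu]_(v in `]s, r]) (expR v)%:E = (expR r - expR s)%:E.
Proof.
by move=> sr; apply: integral_itvoc_is_derive => //; exact: continuous_expR.
Qed.

(** The difference exp(-s) - exp(-r) is the integral of exp(-v) over s < v <= r. This turns exp(-f)
    on {f < r} into measures of the sublevel sets {f < v}. *)
Lemma expRN_layer (s r : R) : (0 <= s)%R ->
  (expR (- s) * (s < r)%R%:R)%:E =
  (expR (- r) * (s < r)%R%:R)%:E +
  \int[mu]_v (((s < v)%R%:R) * (\1_`]0%R, r] v * expR (- v)))%:E.
Proof.
move=> s0.
have -> : \int[mu]_v (((s < v)%R%:R) * (\1_`]0%R, r] v * expR (- v)))%:E =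
          \int[mu]_(v in `]s, r]) (expR (- v))%:E.
  rewrite [RHS]integral_mkcond; apply: eq_integral => v _.
  rewrite patchE indicE !mem_setE !in_itv/=.
  case: (ltP s v) => sv /=; last by rewrite mul0r.
  by rewrite (le_lt_trans s0 sv)/=; case: (v <= r)%R; rewrite /= ?mul1r ?mul0r.
case: (ltP s r) => sr.
  by rewrite integral_itv_expRN ?ltW// !mulr1 -EFinD addrC subrK.
by rewrite !mulr0 set_itv_ge ?integral_set0 ?adde0// bnd_simp -leNgt.
Qed.

(** Counterpart for the growing exponential, with boundary term exp(0) = 1; it serves to express
    E[exp(min(Z, x))] by the tail of Z. *)
Lemma expR_layer (s r : R) : (0 <= s)%R -> (0 <= r)%R ->
  (expR (Num.min s r))%:E =
  1 + \int[mu]_v (((v <= s)%R%:R) * (\1_`]0%R, r] v * expR v))%:E.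
Proof.
move=> s0 r0.
have -> : \int[mu]_v (((v <= s)%R%:R) * (\1_`]0%R, r] v * expR v))%:E =
          \int[mu]_(v in `]0%R, Num.min s r]) (expR v)%:E.
  rewrite [RHS]integral_mkcond; apply: eq_integral => v _.
  rewrite patchE indicE !mem_setE !in_itv/= le_min.
  by case: (v <= s)%R; case: (0 < v)%R; case: (v <= r)%R; rewrite /= ?mul1r ?mul0r.
by rewrite integral_itv_expR ?le_min ?s0// expR0 -EFinD addrC subrK.
Qed.

End disc.

Section sublevel.
Local Open Scope ereal_scope.
Context d (T : measurableType d) (R : realType).
Notation mu := (@lebesgue_measure R).
Notation mR := (measurableTypeR R).
Variables (m : {sigma_finite_measure set T -> \bar R}) (f : T -> R) (c : \bar R).
Hypotheses (mf : measurable_fun setT f) (f0 : forall x, (0 <= f x)%R) (c0 : 0 <= c).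
Hypothesis m_sublevel : forall v, (0 < v)%R -> m [set x | (f x < v)%R] = v%:E * c.

(** Layering gives c times r exp(-r) + \int_0^r v exp(-v) dv, and this sum is 1 - exp(-r). *)
Lemma integral_expRN_sublevel (r : R) : (0 < r)%R ->
  \int[m]_x (expR (- f x) * (f x < r)%R%:R)%:E = c * (1 - expR (- r))%:E.
Proof.
move=> r0.
pose h v : R := (\1_`]0%R, r] v * expR (- v))%R.
have mh : measurable_fun setT h.
  apply: measurable_funM => //.
  exact: continuous_measurable_fun (@continuous_expRN R).
have h0 v : (0 <= h v)%R by rewrite mulr_ge0 ?expR_ge0.
pose A : set (T * mR) := [set q | (f q.1 < q.2)%R].
have mA : measurable A.
  apply: measurable_set_ltr; first exact: measurableT_comp.
  exact: measurable_snd.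
pose D : set T := [set x | (f x < r)%R].
have mD : measurable D by exact: measurable_set_ltr.
have mlayer : measurable_fun setT (fun x => \int[mu]_v (\1_A (x, v) * h v)%:E).
  apply: (measurable_fun_fubini_tonelli_F (m2 := mu) (fun q => (\1_A q * h q.2)%:E)).
    apply/measurable_EFinP; apply: measurable_funM => //.
    exact: measurableT_comp.
  by move=> q; rewrite lee_fin mulr_ge0.
have mI : measurable_fun setT (fun x => (\1_D x)%:E : \bar R).
  by apply/measurable_EFinP; exact: measurable_indic.
have e0 : (0 <= expR (- r))%R by exact: expR_ge0.
transitivity (\int[m]_x ((expR (- r))%:E * (\1_D x)%:E +
    \int[mu]_v (\1_A (x, v) * h v)%:E)).
  apply: eq_integral => x _; rewrite expRN_layer// EFinM; congr (_ * _ + _).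
    by congr (_%:E); rewrite indicE; congr ((_ : bool)%:R); exact/esym/asboolb.
  apply: eq_integral => v _; congr (_ * _)%:E.
  by rewrite indicE; congr ((_ : bool)%:R); exact/esym/asboolb.
rewrite (ge0_integralD m measurableT); last 4 first.
- by move=> x _; rewrite mule_ge0 ?lee_fin.
- exact: measurable_funeM.
- by move=> x _; apply: integral_ge0 => v _; rewrite lee_fin mulr_ge0.
- exact: mlayer.
rewrite (ge0_integralZl m measurableT mI); last 2 first.
- by move=> x _; rewrite lee_fin.
- by rewrite lee_fin.
rewrite integral_layer//.
have -> : \int[m]_x (\1_D x)%:E = r%:E * c.
  by have := integral_indic m measurableT mD; rewrite setIT -m_sublevel.
have -> : \int[mu]_v ((h v)%:E * m [set x | A (x, v)]) =
    \int[mu]_(v in `]0%R, r]) (c * (expR (- v) * v)%:E).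
  rewrite [RHS]integral_mkcond; apply: eq_integral => v _.
  rewrite patchE /h indicE mem_setE in_itv/=.
  case: ltP => v0 /=; last by rewrite mul0r mul0e.
  case: (v <= r)%R; last by rewrite mul0r mul0e.
  rewrite mul1r (_ : m _ = v%:E * c); last by rewrite -m_sublevel.
  by rewrite muleA -EFinM muleC.
rewrite (ge0_integralZl mu (measurable_itv _)); last 3 first.
- apply: measurable_funTS; apply/measurable_EFinP; apply: measurable_funM => //.
  exact: continuous_measurable_fun (@continuous_expRN R).
- move=> v /=; rewrite in_itv/= => /andP[v0 _].
  by rewrite lee_fin mulr_ge0 ?expR_ge0// ltW.
- exact: c0.
rewrite integral_itv_id_expRN// muleA -EFinM muleC.
(* Here [c] may be infinite, so distributivity relies on both terms being nonnegative. *)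
rewrite -ge0_muleDr ?lee_fin//.
- by rewrite -EFinD; congr (_ * _%:E); ring.
- by rewrite mulr_ge0// ltW.
- rewrite subr_ge0 mulrC -ler_pdivlMr ?expR_gt0// expRN invrK mul1r.
  exact: expR_ge1Dx.
Qed.

End sublevel.

Lemma product_sigma_finite d (T : measurableType d) (R : realType)
    (m : {sigma_finite_measure set T -> \bar R}) :
  sigma_finite setT (m \x m)%E.
Proof.
have /sigma_finiteP[F [TF ndF Foo]] := sigma_finiteT m.
exists (fun n => F n `*` F n) => [|n].
  apply/seteqP; split => // -[x y] _.
  have [[i _ Fix] [j _ Fjy]] : (\bigcup_n F n) x /\ (\bigcup_n F n) y by rewrite -TF.
  exists (maxn i j) => //; split => /=.
    by move: x Fix; exact/subsetPset/ndF/leq_maxl.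
  by move: y Fjy; exact/subsetPset/ndF/leq_maxr.
have [mF Fn] := Foo n; split; first exact: measurableX.
by rewrite product_measure1E// lte_mul_pinfty// ge0_fin_numE.
Qed.

Section sqsum_normal.
Local Open Scope ereal_scope.
Context d (T : measurableType d) (R : realType) (P : probability T R).
Notation mu := (@lebesgue_measure R).
Notation mR := (measurableTypeR R).
Variables U V : T -> R.
Hypotheses (mU : measurable_fun setT U) (mV : measurable_fun setT V).
Hypothesis indUV : forall B C, measurable B -> measurable C ->
  P (U @^-1` B `&` V @^-1` C) = P (U @^-1` B) * P (V @^-1` C).

Let mU' : measurable_fun setT (U : T -> mR) := mU.
Let mV' : measurable_fun setT (V : T -> mR) := mV.
Let Um : {mfun T >-> mR} := HB.pack (U : T -> mR) (isMeasurableFun.Build _ _ _ _ _ mU').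
Let Vm : {mfun T >-> mR} := HB.pack (V : T -> mR) (isMeasurableFun.Build _ _ _ _ _ mV').

Lemma pr_pair_set (A : set (mR * mR)) : measurable A ->
  P [set w | A (U w, V w)] =
  \int[distribution P Um]_x \int[distribution P Vm]_y (\1_A (x, y))%:E.
Proof.
move=> mA.
rewrite -(@integral_indep _ _ _ P _ _ _ _ Um Vm indUV (fun z => (\1_A z)%:E)).
- have mA' : measurable [set w | A (U w, V w)].
    rewrite -[X in measurable X]setTI.
    exact: (measurable_fun_pair mU' mV' measurableT mA).
  by have := integral_indic P measurableT mA'; rewrite setIT => <-.
- by apply/measurable_EFinP; exact: measurable_indic.
- by move=> z; rewrite lee_fin.
Qed.

Hypotheses (nU : is_normal P 0 (Num.sqrt 2^-1) U)
           (nV : is_normal P 0 (Num.sqrt 2^-1) V).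

Let s : R := Num.sqrt 2^-1.
Let kappa : R := (normal_peak s ^+ 2)%R.

Let s0 : s != 0%R.
Proof. by rewrite gt_eqF// sqrtr_gt0. Qed.

Let kappa_gt0 : (0 < kappa)%R.
Proof. by rewrite exprn_gt0// normal_peak_gt0. Qed.

(** Standard deviation sqrt(1/2) means 2 s^2 = 1, so the exponent of the planar density is exactly
    -(x^2 + y^2). *)
Let normal_pdfM x y : (normal_pdf 0 s x * normal_pdf 0 s y)%R =
  (kappa * expR (- (x ^+ 2 + y ^+ 2)))%R.
Proof.
rewrite normal_pdfE// /normal_fun !subr0.
have -> : (s ^+ 2 *+ 2 = 1)%R by rewrite sqr_sqrtr// -mulr_natr mulVf.
by rewrite !divr1 mulrACA -expr2 -expRD opprD.
Qed.

Let area (v : R) := (mu \x mu) (disc v).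

(* Scaling gives the area of a disc up to a constant, so polar coordinates are not needed: the
   constant is recovered in [sqsum_normal_law] from the total mass being one. *)
Let area_scale v : (0 < v)%R -> area v = v%:E * area 1.
Proof.
move=> v0; have E w : area w = disc_area w.
  rewrite /disc_area -(fubini_tonelli1 (fun z => (\1_(disc w) z)%:E))//.
  - by have := integral_indic (mu \x mu) measurableT (measurable_disc w); rewrite setIT => ->.
  - exact: measurable_indic_disc.
by rewrite !E disc_area_scale.
Qed.

Let area_ge0 v : 0 <= area v.
Proof. exact: measure_ge0. Qed.

Let sq (z : mR * mR) : R := ((z.1 : R) ^+ 2 + (z.2 : R) ^+ 2)%R.

Let integral_disc_gauss (r : R) : (0 < r)%R ->
  \int[mu \x mu]_z (expR (- sq z) * (sq z < r)%R%:R)%:E =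
  area 1 * (1 - expR (- r))%:E.
Proof.
have msq : measurable_fun setT sq by exact: measurable_sqsum.
have sq0 z : (0 <= sq z)%R by rewrite addr_ge0 ?sqr_ge0.
pose mm : {sigma_finite_measure set (mR * mR)%type -> \bar R} :=
  HB.pack (mu \x mu) (Measure_isSigmaFinite.Build _ _ _ (mu \x mu) (product_sigma_finite mu)).
have H := @integral_expRN_sublevel _ _ R mm sq (area 1) msq sq0 (area_ge0 1) area_scale.
exact: H.
Qed.

Lemma sqsum_normal_lt (r : R) : (0 < r)%R ->
  P [set w | (U w ^+ 2 + V w ^+ 2 < r)%R] = kappa%:E * area 1 * (1 - expR (- r))%:E.
Proof.
move=> r0.
have mf := measurable_indic_disc r.
pose phi := normal_pdf 0 s.
have mphi : measurable_fun setT phi by exact: measurable_normal_pdf.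
have phi0 x : (0 <= phi x)%R by exact: normal_pdf_ge0.
rewrite (pr_pair_set (measurable_disc r)).
have mF (nu : {sigma_finite_measure set mR -> \bar R}) :
    measurable_fun setT (fun x => \int[nu]_y (\1_(disc r) (x, y))%:E).
  apply: (measurable_fun_fubini_tonelli_F (m2 := nu) (fun z => (\1_(disc r) z)%:E) mf).
  by move=> z; rewrite lee_fin.
have dE (G : {mfun T >-> mR}) f : is_normal P 0 s G -> measurable_fun setT f ->
    (forall x, 0 <= f x) ->
    \int[distribution P G]_x f x = \int[mu]_x (f x * (phi x)%:E).
  by move=> nG mf' f0; apply: ge0_integral_density => // A mA; exact: nG.
rewrite (dE Um)//; last by move=> x; apply: integral_ge0 => y _; rewrite lee_fin.
have mx x : measurable_fun setT (fun y : mR => (\1_(disc r) (x, y))%:E : \bar R).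
  by apply: (measurableT_comp mf); exact: (@measurable_pair1 _ _ mR mR).
have mq : measurable_fun setT (fun z : mR * mR => (expR (- sq z) * (sq z < r)%R%:R)%:E).
  apply/measurable_EFinP; apply: measurable_funM.
    apply: measurableT_comp (continuous_measurable_fun (@continuous_expRN R)) _.
    exact: measurable_sqsum.
  rewrite (_ : (fun _ => _) = \1_(disc r)); first exact: measurable_indic (measurable_disc r).
  by apply/funext => z; rewrite indicE mem_setE.
transitivity (\int[mu]_x \int[mu]_y (kappa * (expR (- sq (x, y)) * (sq (x, y) < r)%R%:R))%:E).
  apply: eq_integral => x _; rewrite (dE Vm)//.
  rewrite -ge0_integralZr//.
  - apply: eq_integral => y _; rewrite -!EFinM; congr (_%:E).
    rewrite -mulrA [(phi y * _)%R]mulrC normal_pdfM indicE /disc mem_setE/=.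
    by rewrite mulrC -mulrA.
  - by apply: emeasurable_funM => //; apply/measurable_EFinP.
  - by move=> y _; rewrite mule_ge0 ?lee_fin.
  - by rewrite lee_fin.
rewrite -(fubini_tonelli1 (fun z => (kappa * (expR (- sq z) * (sq z < r)%R%:R))%:E)); last 2 first.
- by under eq_fun do rewrite EFinM; apply: measurable_funeM.
- by move=> z; rewrite lee_fin; apply: mulr_ge0; [exact: ltW|rewrite mulr_ge0 ?expR_ge0].
under eq_integral do rewrite EFinM.
rewrite ge0_integralZl//; last by rewrite lee_fin ltW.
by rewrite integral_disc_gauss// muleA.
Qed.

Lemma sqsum_normal_law (r : R) : (0 < r)%R ->
  P [set w | (U w ^+ 2 + V w ^+ 2 < r)%R] = (1 - expR (- r))%:E.
Proof.
move=> r0; rewrite sqsum_normal_lt//.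
have e1 : (0 < 1 - expR (- (1 : R)))%R by rewrite subr_gt0 expR_lt1 oppr_lt0.
have C0 : 0 <= kappa%:E * area 1 by rewrite mule_ge0// lee_fin ltW.
(* The area constant could still be infinite; it is not, because at r = 1 its product with a
   positive number is a probability. *)
have [C CE] : exists C : R, kappa%:E * area 1 = C%:E.
  have := probability_le1 P (measurable_set_ltr
     (measurable_funD (measurable_funX 2 mU) (measurable_funX 2 mV)) (measurable_cst (1%R : R))).
  rewrite sqsum_normal_lt//.
  case: (kappa%:E * area 1) C0 => [c _ _|_|//]; first by exists c.
  by rewrite gt0_mulye ?lte_fin// leye_eq.
rewrite CE -EFinM; congr (_%:E).
suff -> : C = 1%R by rewrite mul1r.
(* These events exhaust the space, so C (1 - exp(-(n+1))) tends both to 1 and to C. *)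
pose F (n : nat) := [set w | (U w ^+ 2 + V w ^+ 2 < n.+1%:R)%R].
have mF n : measurable (F n).
  by apply: measurable_set_ltr => //; apply: measurable_funD; exact: measurable_funX.
have h1 : P (F n) @[n --> \oo] --> P (\bigcup_n F n).
  apply: nondecreasing_cvg_mu => //; first exact: bigcup_measurable.
  move=> m n mn; apply/subsetPset => w; rewrite /F /= => /lt_le_trans; apply.
  by rewrite ler_nat.
have FT : \bigcup_n F n = setT.
  apply/seteqP; split => // w _; pose x := (U w ^+ 2 + V w ^+ 2)%R.
  exists (Num.truncn x) => //; rewrite /F /=.
  exact: truncnS_gt.
move: h1; rewrite FT probability_setT.
have -> : (fun n => P (F n)) = EFin \o (fun n => C * (1 - expR (- n.+1%:R)))%R.
  by apply/funext => n /=; rewrite /F sqsum_normal_lt// CE EFinM.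
move=> /fine_cvgP[_ h1].
have h2 : (C * (1 - expR (- n.+1%:R)))%R @[n --> \oo] --> (C * (1 - 0))%R.
  apply: cvgMr; apply: cvgB; first exact: cvg_cst.
  by have := @cvgn_expR R; rewrite -(cvg_shiftS (fun n => expR (- n%:R))).
by move: h2; rewrite subr0 mulr1 => h2; apply: (cvg_unique _ h2 h1).
Qed.

End sqsum_normal.

(** * Sums of exponential variables *)

Section erlang.
Local Open Scope ereal_scope.
Context d (T : measurableType d) (R : realType) (P : probability T R).
Notation mu := (@lebesgue_measure R).
Notation mR := (measurableTypeR R).

Lemma pr_ge_lt (X : T -> R) (x : R) : measurable_fun setT X ->
  P [set w | (x <= X w)%R] = 1 - P [set w | (X w < x)%R].
Proof.
move=> mX; rewrite -probability_setC; last exact: measurable_set_ltr.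
by congr (P _); apply/seteqP; split => w /=; rewrite leNgt => /negP.
Qed.

(** Given Z = z, the tail of z + W at x is exp(min(z, x) - x). By layering, E[exp(min(Z, x))] = 1 +
    \int_0^x exp(v) P(Z >= v) dv; the integrand is [expsum k v], so the total is [expsum k.+1 x]. *)
Lemma erlang_step k (Z W : T -> R) :
  measurable_fun setT Z -> measurable_fun setT W ->
  (forall B C, measurable B -> measurable C ->
    P (Z @^-1` B `&` W @^-1` C) = P (Z @^-1` B) * P (W @^-1` C)) ->
  (forall w, 0 <= Z w)%R -> (forall w, 0 <= W w)%R ->
  (forall x, (0 < x)%R -> P [set w | (x <= Z w)%R] = (erlang_tail k x)%:E) ->
  (forall x, (0 < x)%R -> P [set w | (W w < x)%R] = (1 - expR (- x))%:E) ->
  forall x, (0 < x)%R ->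
    P [set w | (x <= Z w + W w)%R] = (erlang_tail k.+1 x)%:E.
Proof.
move=> mZ mW indZW Z0 W0 hZ hW x x0.
pose A : set (mR * mR) := [set z | (x <= (z.1 : R) + (z.2 : R))%R].
have mA : measurable A.
  apply: measurable_set_ler => //; apply: measurable_funD.
    exact: measurable_fst.
  exact: measurable_snd.
have mf : measurable_fun setT (fun z => (\1_A z)%:E : \bar R).
  by apply/measurable_EFinP; exact: measurable_indic.
have tail z : P [set w | A (z, W w)] = (expR (Num.min z x - x))%:E.
  have -> : [set w | A (z, W w)] = [set w | (x - z <= W w)%R].
    by apply/seteqP; split => w; rewrite /A /= lerBlDl.
  have [zx|xz] := ltP z x.
    rewrite pr_ge_lt// hW ?subr_gt0//.
    by rewrite -EFinB opprB addrCA subrr addr0 opprB.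
  rewrite subrr expR0 (_ : [set w | _] = setT) ?probability_setT//.
  apply/seteqP; split => // w _ /=; apply: le_trans (W0 w).
  by rewrite subr_le0.
have -> : P [set w | (x <= Z w + W w)%R] = P [set w | A (Z w, W w)] by [].
rewrite (pr_pair_set mZ mW indZW mA).
set dZ := distribution P _; set dW := distribution P _.
transitivity (\int[dZ]_z (expR (Num.min (z : R) x - x))%:E).
  apply: eq_integral => z _; rewrite -tail.
  have mAz : measurable [set y : mR | A (z, y)].
    rewrite -[X in measurable X]setTI.
    exact: (@measurable_pair1 _ _ mR mR z measurableT A mA).
  by have E := integral_indic dW measurableT mAz; rewrite setIT in E; exact: E.
rewrite ge0_integral_distribution//; last first.
  apply/measurable_EFinP; apply: (measurableT_comp (@measurable_expR R)).
  by apply: measurable_funB => //; exact: measurable_minr.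
pose h v : R := (\1_`]0%R, x] v * expR v)%R.
have mh : measurable_fun setT h by apply: measurable_funM.
have h0 v : (0 <= h v)%R by rewrite mulr_ge0 ?expR_ge0.
pose A' : set (T * mR) := [set q | ((q.2 : R) <= Z q.1)%R].
have mA' : measurable A'.
  apply: measurable_set_ler; first exact: measurable_snd.
  exact: measurableT_comp.
have mlayer : measurable_fun setT (fun w => \int[mu]_v (\1_A' (w, v) * h v)%:E).
  apply: (measurable_fun_fubini_tonelli_F (m2 := mu) (fun q => (\1_A' q * h q.2)%:E)).
    apply/measurable_EFinP; apply: measurable_funM => //.
    exact: measurableT_comp.
  by move=> q; rewrite lee_fin mulr_ge0.
have layer0 w : 0 <= \int[mu]_v (\1_A' (w, v) * h v)%:E.
  by apply: integral_ge0 => v _; rewrite lee_fin mulr_ge0.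
transitivity (\int[P]_w ((expR (- x))%:E *
     (1 + \int[mu]_v (\1_A' (w, v) * h v)%:E))).
  apply: eq_integral => w _ /=.
  transitivity ((expR (- x))%:E * (expR (Num.min (Z w) x))%:E).
    by rewrite -EFinM -expRD [(- x + _)%R]addrC.
  congr (_ * _); rewrite (expR_layer (Z0 w) (ltW x0)); congr (_ + _).
  apply: eq_integral => v _; congr (_ * _)%:E.
  by rewrite indicE; congr ((_ : bool)%:R); exact/esym/asboolb.
rewrite ge0_integralZl//; last 2 first.
- by apply: emeasurable_funD.
- by move=> w _; rewrite adde_ge0.
have -> : \int[P]_w (1 + \int[mu]_v (\1_A' (w, v) * h v)%:E) =
    1 + \int[P]_w \int[mu]_v (\1_A' (w, v) * h v)%:E.
  rewrite ge0_integralD//; congr (_ + _).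
  by rewrite integral_cst// mul1e; exact: probability_setT.
rewrite /erlang_tail EFinM; congr (_ * _).
have -> : \int[P]_w \int[mu]_v (\1_A' (w, v) * h v)%:E =
          \int[mu]_v ((h v)%:E * P [set w | A' (w, v)]) by exact: integral_layer.
have -> : \int[mu]_v ((h v)%:E * P [set w | A' (w, v)]) =
          \int[mu]_(v in `]0%R, x]) (expsum k v)%:E.
  rewrite [RHS]integral_mkcond; apply: eq_integral => v _.
  rewrite patchE /h indicE mem_setE in_itv/=.
  case: ltP => v0 /=; last by rewrite mul0r mul0e.
  case: (v <= x)%R; last by rewrite mul0r mul0e.
  rewrite mul1r (_ : [set w | _] = [set w | (v <= Z w)%R])// hZ//.
  by rewrite /erlang_tail -EFinM mulrA -expRD subrr expR0 mul1r.
by rewrite integral_itv_expsum// -EFinD addrC subrK.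
Qed.

(** The strict tail at x lies between f(x + 1/(n+1)) and f(x), so continuity of [f] excludes an
    atom. *)
Lemma pr_gt_of_ge (X : T -> R) (f : R -> R) : measurable_fun setT X ->
  continuous f -> (forall x, (0 < x)%R -> P [set w | (x <= X w)%R] = (f x)%:E) ->
  forall x, (0 < x)%R -> P [set w | (x < X w)%R] = (f x)%:E.
Proof.
move=> mX cf hX x x0; apply/eqP; rewrite eq_le; apply/andP; split.
  rewrite -hX//; apply: le_measure; rewrite ?inE.
  - exact: measurable_set_ltr.
  - exact: measurable_set_ler.
  - by move=> w /= /ltW.
have hx : (x + n.+1%:R^-1)%R @[n --> \oo] --> x.
  rewrite -[X in _ --> X]addr0; apply: cvgD; first exact: cvg_cst.
  exact: cvg_harmonic.
have fx : f (x + n.+1%:R^-1)%R @[n --> \oo] --> f x.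
  by apply: continuous_cvg hx; exact: cf.
have fin : P [set w | (x < X w)%R] \is a fin_num.
  by rewrite fin_num_measure//; exact: measurable_set_ltr.
rewrite -(fineK fin) lee_fin; apply: (cvgr_to_le fx); near=> n.
rewrite -lee_fin fineK// -hX ?addr_gt0//.
apply: le_measure; rewrite ?inE.
- exact: measurable_set_ler.
- exact: measurable_set_ltr.
- by move=> w /=; apply: lt_le_trans; rewrite ltrDl.
Unshelve. all: by end_near. Qed.

End erlang.

(** * Sums of the largest values and exceedance counts *)

(** In a nonincreasing list the entries that are at least [v] form a prefix. *)
Lemma count_take_sorted (R : realType) (v : R) (l : nat) (s : seq R) :
  sorted (fun x y => y <= x) s ->
  count (fun x => v <= x) (take l s) = minn l (count (fun x => v <= x) s).
Proof.
elim: s l => [|x s IH] [|l]; rewrite ?minn0 ?min0n//= => ss.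
have sss := path_sorted ss.
rewrite IH//; case: (leP v x) => vx; first by rewrite /= !add1n minnSS.
have -> : count (fun x0 => v <= x0) s = 0%N.
  apply/eqP; rewrite -leqn0 leqNgt -has_count; apply/hasPn => y ys.
  have tr : transitive (fun x y : R => y <= x) by move=> a b c ab ca; exact: le_trans ca ab.
  have /allP/(_ _ ys) yx := order_path_min tr ss.
  by rewrite -ltNge (le_lt_trans yx vx).
by rewrite !minn0.
Qed.

Section sum_layer.
Local Open Scope ereal_scope.
Variable R : realType.
Notation mu := (@lebesgue_measure R).

Lemma measurable_count_ge (s : seq R) :
  measurable_fun setT (fun v : R => (count (fun x => (v <= x)%R) s)%:R : R).
Proof.
elim: s => [|x s IH] /=; first exact: measurable_cst.
under eq_fun do rewrite natrD; apply: measurable_funD => //.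
rewrite (_ : (fun _ => _) = \1_`]-oo, x]) //; apply/funext => v.
by rewrite indicE mem_setE in_itv/=.
Qed.

Lemma sum_layer (s : seq R) : all (fun x => (0 <= x)%R) s ->
  (\sum_(x <- s) x)%R%:E =
  \int[mu]_v (\1_`]0%R, +oo[ v * (count (fun x => (v <= x)%R) s)%:R)%:E.
Proof.
elim: s => [_|x s IH /= /andP[x0 s0]].
  by rewrite big_nil; under eq_integral do rewrite /= mulr0; rewrite integral0.
rewrite big_cons EFinD IH//.
have -> : x%:E = \int[mu]_v (\1_`]0%R, +oo[ v * (v <= x)%R%:R)%:E.
  transitivity (\int[mu]_v (\1_`]0%R, x] v)%:E).
    transitivity (mu `]0%R, x]%classic); last exact/esym/integral_indicT.
    rewrite lebesgue_measure_itv/= lte_fin.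
    by move: x0; rewrite le_eqVlt => /predU1P[<-|->]; rewrite ?ltxx// oppr0 adde0.
  apply: eq_integral => v _; rewrite !indicE !mem_setE !in_itv/= andbT.
  by case: (0 < v)%R; case: (v <= x)%R; rewrite ?mul1r ?mul0r.
rewrite -ge0_integralD//.
- by apply: eq_integral => v _; rewrite -EFinD -mulrDr natrD.
- by apply/measurable_EFinP; apply: measurable_funM => //;
     have := measurable_count_ge [:: x]; under eq_fun do rewrite /= addn0.
- by apply/measurable_EFinP; apply: measurable_funM => //; exact: measurable_count_ge.
Qed.

Lemma sum_largest_layer (l : nat) (s : seq R) : all (fun x => (0 <= x)%R) s ->
  (sum_largest l s)%:E =
  \int[mu]_v (\1_`]0%R, +oo[ v * (minn l (count (fun x => (v <= x)%R) s))%:R)%:E.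
Proof.
move=> s0; rewrite /sum_largest; set s' := sort _ s.
have tot : total (fun x y : R => (y <= x)%R) by move=> x y; exact: le_total.
rewrite sum_layer; last first.
  by apply/allP => x /mem_take; rewrite mem_sort => /(allP s0).
apply: eq_integral => v _; rewrite count_take_sorted ?sort_sorted//.
by rewrite (permP (permEl (perm_sort _ s))).
Qed.

End sum_layer.

(** * Binomial law of the exceedance counts *)

Section binomial_count.
Local Open Scope ereal_scope.
Context d (T : measurableType d) (R : realType) (P : probability T R).
Variables (X : nat -> T -> R) (n : nat) (v p : R).
Hypothesis indX : mutually_independent P X.
Hypothesis pX : forall m, P [set w | (v <= X m w)%R] = p%:E.

Definition count_ge (w : T) : nat := count (fun x => (v <= x)%R) [seq X m w | m <- iota 0 n].

Let mX m : measurable_fun setT (X m). Proof. by case: indX. Qed.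

Let S w : {set 'I_n} := [set i : 'I_n | (v <= X i w)%R]%SET.

Let count_geE w : count_ge w = #|S w|.
Proof.
rewrite /count_ge count_map -sum1_count -sum1_card.
rewrite -[in iota _ _](subn0 n) -/(index_iota 0 n) big_mkord.
by apply: eq_bigl => i; rewrite [RHS]finset.in_set.
Qed.

(** Exact pattern of exceedances. These events partition the space, and each is an intersection of
    half-line events for the single variables, so independence gives its probability. *)
Let hits (A : {set 'I_n}) := [set w | S w == A].

Let B (A : {set 'I_n}) (m : nat) : set R :=
  if m \in [seq val i | i <- enum A] then `[v, +oo[%classic else `]-oo, v[%classic.

Let mB A m : measurable (B A m).
Proof. by rewrite /B; case: ifP. Qed.

Let mem_A (A : {set 'I_n}) (i : 'I_n) :
  (val i \in [seq val i | i <- enum A]) = (i \in A).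
Proof. by rewrite mem_map ?mem_enum//; exact: val_inj. Qed.

Let hitsE A : hits A = \big[setI/setT]_(m <- iota 0 n) X m @^-1` B A m.
Proof.
rewrite -bigcap_seq; apply/seteqP; split => [w /eqP <- m /=|w hw].
  rewrite mem_iota /= add0n => mn; pose i := Ordinal mn.
  rewrite -[m]/(val i) /B mem_A inE.
  by case: ifPn => /=; rewrite in_itv/= ?andbT// -ltNge.
apply/eqP/setP => i; rewrite inE.
have /(_ _)/= := hw (val i); rewrite mem_iota/= add0n ltn_ord => /(_ isT).
rewrite /B mem_A; case: ifPn => _ /=; rewrite in_itv/= ?andbT//.
by rewrite ltNge => /negbTE.
Qed.

Let mhits A : measurable (hits A).
Proof.
rewrite hitsE; apply: bigsetI_measurable => m _.
by rewrite -[X in measurable X]setTI; exact: mX.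
Qed.

Let P_hits A : P (hits A) = (p ^+ #|A| * (1 - p) ^+ (n - #|A|))%:E.
Proof.
have [_ ind] := indX.
rewrite hitsE ind ?iota_uniq//.
rewrite -[in iota _ _](subn0 n) -/(index_iota 0 n) big_mkord.
rewrite (eq_bigr (fun i : 'I_n => (if i \in A then p else 1 - p)%:E)); last first.
  move=> i _; rewrite /B mem_A; case: ifPn => _.
    by rewrite -(pX i); congr (P _); apply/seteqP; split => w /=; rewrite in_itv/= andbT.
  have -> : X i @^-1` `]-oo, v[%classic = ~` [set w | (v <= X i w)%R].
    apply/seteqP; split => w /=; rewrite in_itv/= ltNge; first by move/negP.
    by move=> /negP.
  by rewrite probability_setC ?pX//; exact: measurable_set_ler.
rewrite prodEFin; congr (_%:E).
rewrite (bigID (mem A))/= (eq_bigr (fun=> p)); last by move=> i ->.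
rewrite [X in (_ * X)%R](eq_bigr (fun=> 1 - p)%R); last by move=> i /negbTE ->.
rewrite prodr_const (eq_bigl (mem (~: A)%SET)); last by move=> i; rewrite /= finset.in_setC.
by rewrite prodr_const cardsCs finset.setCK card_ord.
Qed.

Lemma expectation_count (g : nat -> R) : (forall j, 0 <= g j)%R ->
  \int[P]_w (g (count_ge w))%:E =
  (\sum_(j < n.+1) g j * 'C(n, j)%:R * p ^+ j * (1 - p) ^+ (n - j))%R%:E.
Proof.
move=> g0.
transitivity (\int[P]_w \sum_(A : {set 'I_n}) (g #|A|)%:E * (\1_(hits A) w)%:E).
  apply: eq_integral => w _; rewrite (bigD1 (S w))//= big1 ?adde0.
    by rewrite indicE mem_set ?mule1 ?count_geE//= /hits/=.
  by move=> A /negbTE AS; rewrite indicE memNset ?mule0//= /hits/= eq_sym AS.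
have mI A : measurable_fun setT (fun w => (\1_(hits A) w)%:E : \bar R).
  by apply/measurable_EFinP; exact: measurable_indic.
rewrite (ge0_integral_sum P measurableT); last 2 first.
- by move=> A; exact: measurable_funeM.
- by move=> A w _; rewrite mule_ge0 ?lee_fin.
rewrite (eq_bigr (fun A : {set 'I_n} =>
    (g #|A| * (p ^+ #|A| * (1 - p) ^+ (n - #|A|)))%:E)); last first.
  move=> A _; rewrite (ge0_integralZl P measurableT (mI A)); last 2 first.
  - by move=> w _; rewrite lee_fin.
  - by rewrite lee_fin.
  have -> : \int[P]_w (\1_(hits A) w)%:E = P (hits A) by exact: integral_indicT.
  by rewrite P_hits -EFinM.
rewrite sumEFin; congr (_%:E).
have cA (A : {set 'I_n}) : (#|A| < n.+1)%N by rewrite ltnS -[leqRHS]card_ord max_card.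
(* Patterns are grouped by cardinality, which produces the binomial coefficient. *)
rewrite (partition_big (fun A : {set 'I_n} => Ordinal (cA A)) xpredT)//=.
apply: eq_bigr => j _.
rewrite (eq_bigr (fun=> g j * (p ^+ j * (1 - p) ^+ (n - j)))%R); last first.
  by move=> A /eqP <-.
rewrite (eq_bigl (mem [set A : {set 'I_n} | #|A| == j]%SET)); last first.
  by move=> A; rewrite /= inE -val_eqE.
rewrite big_const iter_addr_0 card_draws card_ord -mulr_natr.
by ring.
Qed.

Lemma expectation_count_ge : \int[P]_w (count_ge w)%:R%:E = (n%:R * p)%:E.
Proof.
transitivity (\int[P]_w \sum_(m <- iota 0 n) (\1_[set w | (v <= X m w)%R] w)%:E).
  apply: eq_integral => w _; rewrite /count_ge count_map sumEFin; congr (_%:E).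
  rewrite -sum1_count natr_sum big_mkcond; apply: eq_bigr => m _ /=.
  by rewrite indic_setE; case: ifP.
have mI m : measurable [set w | (v <= X m w)%R] by exact: measurable_set_ler.
rewrite (ge0_integral_sum P measurableT); last 2 first.
- by move=> m; apply/measurable_EFinP; exact: measurable_indic.
- by move=> m w _; rewrite lee_fin.
rewrite (eq_bigr (fun=> p%:E)); last first.
  by move=> m _; rewrite -(pX m); exact: integral_indicT.
by rewrite sumEFin big_const_seq count_predT size_iota iter_addr_0 mulr_natl.
Qed.

End binomial_count.

(** * The law of the fading power *)

Section fading_power.
Local Open Scope ereal_scope.
Context d (T : measurableType d) (R : realType) (P : probability T R).
Variables (L : nat) (G : nat * 'I_L * bool -> T -> R).
Hypothesis Gind : mutually_independent P G.
Hypothesis Gnorm : forall i, is_normal P 0 (Num.sqrt (2^-1)) (G i).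

Let Q (m : nat) (j : 'I_L) (w : T) : R :=
  ((G (m, j, true) w) ^+ 2 + (G (m, j, false) w) ^+ 2)%R.

Definition power (m : nat) (w : T) : R := (\sum_(j < L) Q m j w)%R.

Let Z (m k : nat) (w : T) : R := (\sum_(j < L | (j < k)%N) Q m j w)%R.

Let Q_ge0 m j w : (0 <= Q m j w)%R.
Proof. by rewrite addr_ge0 ?sqr_ge0. Qed.

Let Z_ge0 m k w : (0 <= Z m k w)%R.
Proof. exact: sumr_ge0. Qed.

Lemma power_ge0 m w : (0 <= power m w)%R.
Proof. exact: sumr_ge0. Qed.

(** [JQ] and [JZ] hold the Gaussian coordinates read by branch [k] and by the branches before it;
    they are disjoint, whence the independence that [erlang_step] asks for. *)
Let JQ m k : pred (nat * 'I_L * bool) := fun i => (i.1.1 == m) && (i.1.2 == k :> nat).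
Let JZ m k : pred (nat * 'I_L * bool) := fun i => (i.1.1 == m) && (i.1.2 < k)%N.

Let sigma_Q m (j : 'I_L) : sigma_fun G (JQ m j) (Q m j).
Proof.
apply: measurable_funD; apply: measurable_funX.
  by apply: (sigma_fun_coord (J := JQ m j)); rewrite unfold_in /JQ/= !eqxx.
by apply: (sigma_fun_coord (J := JQ m j)); rewrite unfold_in /JQ/= !eqxx.
Qed.

Let Z0 m : Z m 0 = cst 0%R.
Proof. by apply/funext => w; rewrite /Z big_pred0. Qed.

Let ZS m k (kL : (k < L)%N) : Z m k.+1 = (fun w => Z m k w + Q m (Ordinal kL) w)%R.
Proof.
apply/funext => w; rewrite /Z (bigD1 (Ordinal kL))//= addrC; congr (_ + _)%R.
by apply: eq_bigl => j; rewrite -val_eqE/= ltnS ltn_neqAle andbC.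
Qed.

Let sigma_Z m k : (k <= L)%N -> sigma_fun G (JZ m k) (Z m k).
Proof.
elim: k => [_|k IH kL]; first by rewrite Z0; exact: measurable_cst.
rewrite (ZS m kL); apply: measurable_funD.
  apply: sigma_fun_sub (IH (ltnW kL)) => i; rewrite !unfold_in /JZ => /andP[-> h] /=.
  exact: ltnW.
apply: (sigma_fun_sub _ (@sigma_Q m (Ordinal kL))) => i.
by rewrite !unfold_in /JZ /JQ /= => /andP[-> /eqP ->] /=.
Qed.

Let powerE m : power m = Z m L.
Proof.
by apply/funext => w; rewrite /power /Z; apply: eq_bigl => j; rewrite ltn_ord.
Qed.

Lemma power_independent : mutually_independent P power.
Proof.
apply: (mutually_independent_blocks Gind (J := fun m i => i.1.1 == m)).
  move=> k k' kk' i; rewrite !unfold_in => /eqP ->; exact: kk'.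
move=> m; rewrite powerE; apply: (sigma_fun_sub _ (@sigma_Z m L (leqnn L))) => i.
by rewrite !unfold_in => /andP[].
Qed.

Let Q_law m j (x : R) : (0 < x)%R -> P [set w | (Q m j w < x)%R] = (1 - expR (- x))%:E.
Proof.
have mG i : measurable_fun setT (G i) by case: Gind.
move=> x0; apply: (sqsum_normal_law (mG (m, j, true)) (mG (m, j, false))) => // B C mB mC.
apply: (sigma_fun_indep Gind (J := pred1 (m, j, true)) (J' := pred1 (m, j, false))) => //.
- by move=> i; rewrite !inE => /eqP ->; rewrite !xpair_eqE andbF.
- by apply: sigma_fun_coord; rewrite inE.
- by apply: sigma_fun_coord; rewrite inE.
Qed.

Let Z_law m k (x : R) : (k <= L)%N -> (0 < x)%R ->
  P [set w | (x <= Z m k w)%R] = (erlang_tail k x)%:E.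
Proof.
elim: k x => [x _ x0|k IH x kL x0].
  rewrite Z0 /erlang_tail /expsum big_ord0 mulr0 (_ : [set w | _] = set0) ?measure0//.
  by apply/seteqP; split => // w /=; rewrite leNgt x0.
rewrite (ZS m kL); apply: erlang_step x0 => //.
- exact: (sigma_fun_measurable Gind (@sigma_Z m k (ltnW kL))).
- exact: (sigma_fun_measurable Gind (@sigma_Q m (Ordinal kL))).
- move=> B C mB mC.
  apply: (sigma_fun_indep Gind _ (@sigma_Z m k (ltnW kL)) (@sigma_Q m (Ordinal kL))) => //.
  move=> i; rewrite !unfold_in /JZ /JQ => /andP[-> h] /=.
  by rewrite neq_ltn h.
- by move=> y y0; exact: IH (ltnW kL) y0.
- by move=> y y0; exact: Q_law.
Qed.

Lemma power_law m (x : R) : (0 < x)%R ->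
  P [set w | (x <= power m w)%R] = (erlang_tail L x)%:E.
Proof. by move=> x0; rewrite powerE; exact: Z_law. Qed.

End fading_power.

(** * Quantiles and scales *)

Section quantile.
Variables (R : realType) (L : nat).
Hypothesis L0 : (0 < L)%N.
Implicit Types (x v : R) (a b : nat -> R).

Lemma erlang_tail_le_inv v : 0 <= v ->
  erlang_tail L v <= 2 ^+ L / (1 + v / 2).
Proof.
move=> v0; have v2 : 0 < 1 + v / 2 by rewrite ltr_wpDr ?divr_ge0.
apply: le_trans (erlang_tail_le_half L v0) _.
rewrite ler_wpM2l ?exprn_ge0// expRN lef_pV2 ?posrE ?expR_gt0//.
exact: expR_ge1Dx.
Qed.

Lemma erlang_tail_quantile (n : nat) : (1 < n)%N ->
  exists2 x : R, 0 < x & erlang_tail L x = n%:R^-1.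
Proof.
move=> n1; have n0 : 0 < n%:R :> R by rewrite ltr0n ltnW.
(* Then 1 + M/2 exceeds 2^L n, which puts the tail at [M] below 1/n. *)
pose M : R := 2 * (2 ^+ L * n%:R).
have M0 : 0 <= M by rewrite !mulr_ge0 ?exprn_ge0 ?ler0n.
have nV1 : n%:R^-1 < 1 :> R by rewrite invf_lt1// ltr1n.
have SM : erlang_tail L M <= n%:R^-1.
  apply: le_trans (erlang_tail_le_inv M0) _.
  rewrite ler_pdivrMr ?ltr_wpDr ?divr_ge0// ler_pdivlMl//.
  by rewrite mulrC /M mulrAC mulfV// mul1r lerDr.
have [||x] := @IVT _ (@erlang_tail R L) 0 M n%:R^-1 M0.
- exact: continuous_subspaceT (@continuous_erlang_tail R L).
- rewrite erlang_tail_at0// ge_min le_max SM orbT /=.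
  by rewrite ltW.
rewrite in_itv/= => /andP[x0 _] xE; exists x => //.
rewrite lt_neqAle x0 andbT eq_sym; apply: contra_eq_neq xE => ->.
by rewrite erlang_tail_at0// gt_eqF.
Qed.

(** The tail is continuous and strictly decreasing, so the infimum is attained at the solution of
    p(x) = 1/n. For a distribution function and n = 1 the set is the whole line, whose [inf] is a
    default value; hence 1 < n. *)
Lemma a_seq_quantile (F : R -> R) (n : nat) : (1 < n)%N ->
  (forall x, 0 < x -> 1 - F x = erlang_tail L x) ->
  {homo F : x y / x <= y} ->
  0 < a_seq F n /\ erlang_tail L (a_seq F n) = n%:R^-1.
Proof.
move=> n1 FE Fmon; have [x x0 xE] := erlang_tail_quantile n1.
suff -> : a_seq F n = x by [].
have lb : lbound [set x : R | 1 - F x <= n%:R^-1] x.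
  move=> y /=; apply: contraTT; rewrite -!ltNge => yx.
  (* [F] is tied to the tail at positive points only, so [y], possibly negative, is raised to a
     positive point still below [x]. *)
  pose z := Num.max y (x / 2).
  have z0 : 0 < z by rewrite lt_max divr_gt0 ?orbT.
  have zx : z < x by rewrite gt_max yx /=; lra.
  rewrite -xE; apply: lt_le_trans (erlang_tail_decr L0 (ltW z0) zx) _.
  by rewrite -FE// lerB// Fmon// le_max lexx.
have Ax : 1 - F x <= n%:R^-1 by rewrite FE// xE.
apply/eqP; rewrite eq_le /a_seq ge_inf//=; last by exists x.
by apply: lb_le_inf => //; exists x.
Qed.

(** If a_n < B then 1/n = p(a_n) > p(B) > 0, which fails for large n. *)
Lemma quantile_cvgy a : (forall n, (1 < n)%N -> 0 < a n /\ erlang_tail L (a n) = n%:R^-1) ->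
  a n @[n --> \oo] --> +oo.
Proof.
move=> ha; apply/cvgryPge => A; pose B := Num.max A 0.
have B0 : 0 <= B by rewrite le_max lexx orbT.
have SB : 0 < erlang_tail L B by exact: erlang_tail_gt0.
have AB : A <= B by rewrite le_max lexx.
near=> n; apply: le_trans AB _.
have n1 : (1 < n)%N by near: n; exact: nbhs_infty_gt.
have [an0 anE] := ha n n1.
rewrite leNgt; apply/negP => /(erlang_tail_decr L0 (ltW an0)).
rewrite anE; apply/negP; rewrite -leNgt.
have n0 : 0 < n%:R :> R by rewrite ltr0n ltnW.
rewrite -[leRHS]invrK lef_pV2 ?posrE ?invr_gt0//.
by near: n; exact: nbhs_infty_ger.
Unshelve. all: by end_near. Qed.

Lemma b_ofE x : b_of L x = (\sum_(i < L) (L - i)%:R / i`!%:R * x ^+ i) / expsum L x.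
Proof.
by rewrite /b_of; congr (_ / _); apply: eq_bigr => i _; rewrite mul1r mulrC.
Qed.

Lemma b_of_ge1 x : 0 <= x -> 1 <= b_of L x.
Proof.
move=> x0; rewrite b_ofE ler_pdivlMr ?mul1r; last first.
  by rewrite (lt_le_trans ltr01)// expsum_ge1.
apply: ler_sum => i _.
have -> : (L - i)%:R / i`!%:R * x ^+ i = (L - i)%:R * (x ^+ i / i`!%:R) by ring.
rewrite ler_peMl ?divr_ge0 ?exprn_ge0//.
by rewrite ler1n subn_gt0.
Qed.

(** Split L - i = 1 + (L - 1 - i). The second part vanishes at i = L - 1, so it is at most (L - 1)
    [expsum (L - 1) x], which [expsum_ratio] bounds by (L - 1)^2 / x times [expsum L x]. *)
Lemma b_of_le x : 0 < x -> b_of L x <= 1 + L%:R ^+ 2 / x.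
Proof.
move=> x0; have e0 : 0 < expsum L x.
  by rewrite (lt_le_trans ltr01)// expsum_ge1// ltW.
rewrite b_ofE ler_pdivrMr// mulrDl mul1r.
have [K LK] : exists K, L = K.+1 by exists L.-1; rewrite prednK.
have h : \sum_(i < L) (L - i)%:R / i`!%:R * x ^+ i <=
    expsum L x + K%:R * expsum K x.
  rewrite LK expsumS /expsum big_ord_recr/= subSnn mul1r addrAC.
  rewrite [_^-1 * _]mulrC lerD2r mulr_sumr -big_split/=.
  apply: ler_sum => i _.
  rewrite -[X in _ <= X + _]mul1r -mulrDl.
  have -> : (K.+1 - i)%:R / i`!%:R * x ^+ i = (K.+1 - i)%:R * (x ^+ i / i`!%:R) by ring.
  by rewrite ler_wpM2r ?divr_ge0 ?exprn_ge0 ?(ltW x0)// addrC natr1 ler_nat leq_subr.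
apply: le_trans h _; rewrite lerD2l.
rewrite -mulrAC ler_pdivlMr// -mulrA [expsum K x * x]mulrC.
apply: (@le_trans _ _ (K%:R * (K%:R * expsum K.+1 x))).
  by rewrite ler_wpM2l// expsum_ratio// ltW.
rewrite -LK mulrA expr2 ler_wpM2r ?(ltW e0)//.
by rewrite -!natrM ler_nat LK leq_mul.
Qed.

Lemma cvg_inv_y a : a n @[n --> \oo] --> +oo -> (a n)^-1 @[n --> \oo] --> (0 : R).
Proof.
move=> ay; apply/gtr0_cvgV0 => //.
by move/cvgryPgt : ay; exact.
Qed.

Lemma b_of_cvg a : a n @[n --> \oo] --> +oo -> b_of L (a n) @[n --> \oo] --> (1 : R).
Proof.
move=> ay; have aV := cvg_inv_y ay.
have h : 1 + L%:R ^+ 2 / a n @[n --> \oo] --> (1 : R).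
  rewrite -[X in _ --> X]addr0 -[X in _ --> _ + X](mulr0 (L%:R ^+ 2)).
  by apply: cvgD; [exact: cvg_cst|exact: cvgMr].
apply: (@squeeze_cvgr _ _ _ _ (cst 1) (fun n => 1 + L%:R ^+ 2 / a n)) => //; last exact: cvg_cst.
near=> n; have a0 : 0 < a n by near: n; move/cvgryPgt : ay; exact.
by rewrite b_of_ge1 ?b_of_le// ltW.
Unshelve. all: by end_near. Qed.

(** With x + v = q x, a monomial of degree i < L is multiplied by q^i, where q lies in
    [1 - e, 1 + e]. *)
Lemma expsum_ratio_bounds x v (e := `|v| / x) : 0 < x -> e <= 1 ->
  (1 - e) ^+ L * expsum L x <= expsum L (x + v) <= (1 + e) ^+ L * expsum L x.
Proof.
move=> x0 e1; have e0 : 0 <= e by rewrite divr_ge0// ltW.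
pose q := 1 + v / x.
have xq : x + v = x * q by rewrite /q mulrDr mulr1 mulrCA mulfV ?mulr1// gt_eqF.
have : `|v / x| <= e by rewrite normrM normfV (gtr0_norm x0).
rewrite ler_norml => /andP[q1 q2].
have ql : 1 - e <= q by rewrite lerD2l.
have qr : q <= 1 + e by rewrite lerD2l.
have e10 : 0 <= 1 - e by rewrite subr_ge0.
have q0 : 0 <= q by exact: le_trans ql.
rewrite /expsum xq !mulr_sumr; apply/andP; split; apply: ler_sum => i _.
  rewrite exprMn [leRHS](_ : _ = q ^+ i * (x ^+ i / i`!%:R)); last by ring.
  rewrite ler_wpM2r ?divr_ge0 ?exprn_ge0 ?(ltW x0)//.
  apply: (@le_trans _ _ ((1 - e) ^+ i)); last by rewrite lerXn2r ?nnegrE.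
  by apply: ler_wiXn2l => //; rewrite ?gerBl// ltnW.
rewrite exprMn [leLHS](_ : _ = q ^+ i * (x ^+ i / i`!%:R)); last by ring.
rewrite ler_wpM2r ?divr_ge0 ?exprn_ge0 ?(ltW x0)//.
have e1' : 0 <= 1 + e by rewrite addr_ge0.
apply: (@le_trans _ _ ((1 + e) ^+ i)); first by rewrite lerXn2r ?nnegrE.
by apply: ler_weXn2l; rewrite ?lerDl// ltnW.
Qed.

(** The exponential factors leave exp(-b_n u); the ratio of the polynomial factors tends to 1
    because the relative shift |b_n u| / a_n vanishes. *)
Lemma erlang_tail_ratio_cvg a b (u : R) :
  a n @[n --> \oo] --> +oo -> b n @[n --> \oo] --> (1 : R) ->
  erlang_tail L (a n + b n * u) / erlang_tail L (a n) @[n --> \oo] --> expR (- u).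
Proof.
move=> ay b1; have aV := cvg_inv_y ay.
have bu : b n * u @[n --> \oo] --> u.
  by rewrite -[X in _ --> X]mul1r; apply: cvgMl.
pose e n := `|b n * u| / a n.
have e0 : e n @[n --> \oo] --> (0 : R).
  rewrite -[X in _ --> X](mulr0 `|u|); apply: cvgM => //.
  exact: cvg_norm.
have hexp : expR (- (b n * u)) @[n --> \oo] --> expR (- u).
  by apply: continuous_cvg; [exact: continuous_expR|exact: cvgN].
have pw c : (1 + c * e n) ^+ L @[n --> \oo] --> (1 : R).
  rewrite -[X in _ --> X](expr1n _ L).
  have h : 1 + c * e n @[n --> \oo] --> (1 : R).
    rewrite -[X in _ --> X]addr0 -[X in _ --> _ + X](mulr0 c).
    by apply: cvgD; [exact: cvg_cst|exact: cvgMr].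
  exact: (cvg_comp (fun n => 1 + c * e n) (fun x : R => x ^+ L) h (@exprn_continuous R L 1)).
have ratio : expsum L (a n + b n * u) / expsum L (a n) @[n --> \oo] --> (1 : R).
  apply: (@squeeze_cvgr _ _ _ _ (fun n => (1 + (-1) * e n) ^+ L) (fun n => (1 + 1 * e n) ^+ L)).
  - near=> n; have a0 : 0 < a n by near: n; move/cvgryPgt : ay; exact.
    have en1 : e n <= 1 by near: n; apply: (cvgr_le _ e0); exact: ltr01.
    have ex0 : 0 < expsum L (a n).
      by rewrite (lt_le_trans ltr01)// expsum_ge1// ltW.
    rewrite mulN1r mul1r ler_pdivlMr// ler_pdivrMr//.
    exact: expsum_ratio_bounds.
  - exact: pw.
  - exact: pw.
have -> : (fun n => erlang_tail L (a n + b n * u) / erlang_tail L (a n)) =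
    (fun n => expR (- (b n * u)) * (expsum L (a n + b n * u) / expsum L (a n))).
  apply/funext => n; rewrite /erlang_tail opprD expRD.
  set E := expR (- a n); have E0 : E != 0 by rewrite gt_eqF ?expR_gt0.
  rewrite [LHS](_ : _ = E / E * (expR (- (b n * u)) *
    (expsum L (a n + b n * u) / expsum L (a n)))); last by rewrite invfM; ring.
  by rewrite mulfV// mul1r.
by rewrite -[X in _ --> X]mulr1; exact: cvgM.
Unshelve. all: by end_near. Qed.

End quantile.

(** * Truncated binomial counts and their Poisson limit *)

(* E[(l - B)^+] for B binomial(n, p), so that E[min(l, B)] is [l - binomial_defect l n p];
   [poisson_defect l x] is the same quantity for a Poisson(x) variable. *)
Definition binomial_defect (R : realType) (l n : nat) (p : R) : R :=
  \sum_(j < l) (l - j)%:R * 'C(n, j)%:R * p ^+ j * (1 - p) ^+ (n - j).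

Definition poisson_defect (R : realType) (l : nat) (x : R) : R :=
  \sum_(j < l) (l - j)%:R * (x ^+ j / j`!%:R * expR (- x)).

Section defect.
Variable R : realType.
Implicit Types (p : R).

Lemma binomial_defect_ge0 l n p : 0 <= p -> p <= 1 -> 0 <= binomial_defect l n p.
Proof.
move=> p0 p1; apply: sumr_ge0 => j _.
by rewrite !mulr_ge0 ?exprn_ge0 ?subr_ge0 ?ler0n.
Qed.

Lemma onem_exp_le n p : p <= 1 -> (1 - p) ^+ n <= expR (- (n%:R * p)).
Proof.
move=> p1; rewrite -mulrN expRM_natl lerXn2r ?nnegrE ?subr_ge0 ?expR_ge0//.
exact: expR_ge1Dx.
Qed.

(** Invert 1/(1 - p) = 1 + p/(1 - p) <= exp(p/(1 - p)) and raise to the power n. *)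
Lemma onem_exp_ge n p : p < 1 -> expR (- (n%:R * (p / (1 - p)))) <= (1 - p) ^+ n.
Proof.
move=> p1; have q0 : 0 < 1 - p by rewrite subr_gt0.
rewrite -mulrN expRM_natl lerXn2r ?nnegrE ?expR_ge0 ?(ltW q0)//.
rewrite expRN -[leRHS]invrK lef_pV2 ?posrE ?expR_gt0 ?invr_gt0//.
apply: le_trans (expR_ge1Dx _); rewrite le_eqVlt; apply/orP; left; apply/eqP.
by field; rewrite gt_eqF.
Qed.

Lemma binomial_ffact n j : 'C(n, j)%:R = (n ^_ j)%:R / j`!%:R :> R.
Proof.
by rewrite -bin_ffact natrM mulfK// gt_eqF// fact_gt0R.
Qed.

Lemma ffact_le_exp n j : (n ^_ j <= n ^ j)%N.
Proof.
elim: j => // j IH; by rewrite ffactnSr expnSr leq_mul// leq_subr.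
Qed.

(** With x = n p, term j is at most l exp(l) times x^j / j! exp(-x), where exp(l) pays for the
    exponent n - j in place of n; and x^(j+1) <= (j+1)! exp(x) bounds the last factor by l / x. The
    weight, j + 1 and the number of terms contribute one l each. *)
Lemma binomial_defect_le l n p : 0 <= p -> p <= 1 -> 0 < n%:R * p ->
  binomial_defect l n p <= l%:R ^+ 3 * expR l%:R / (n%:R * p).
Proof.
move=> p0 p1 x0; set x := n%:R * p.
have -> : l%:R ^+ 3 * expR l%:R / x = \sum_(j < l) l%:R * (l%:R * expR l%:R / x).
  by rewrite sumr_const card_ord -[RHS]mulr_natl; ring.
apply: ler_sum => j _; rewrite -!mulrA; apply: ler_pM => //.
- by rewrite !mulr_ge0 ?exprn_ge0 ?subr_ge0 ?ler0n.
- by rewrite ler_nat leq_subr.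
have jl : (j.+1)%:R <= l%:R :> R by rewrite ler_nat.
have h1 : 'C(n, j)%:R * p ^+ j <= x ^+ j / j`!%:R.
  rewrite binomial_ffact mulrAC ler_wpM2r ?invr_ge0//.
  by rewrite exprMn ler_wpM2r ?exprn_ge0// -natrX ler_nat ffact_le_exp.
have h2 : (1 - p) ^+ (n - j) <= expR l%:R * expR (- x).
  apply: le_trans (onem_exp_le _ p1) _; rewrite -expRD ler_expR.
  rewrite lerNl opprB lerBlDr.
  have nj : n%:R <= (n - j)%:R + j%:R :> R by rewrite -natrD ler_nat addnC -leq_subLR.
  apply: (@le_trans _ _ (((n - j)%:R + j%:R) * p)); first by rewrite ler_wpM2r.
  rewrite mulrDl lerD2l; apply: (@le_trans _ _ j%:R).
    by rewrite ler_piMr.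
  by rewrite ler_nat ltnW.
apply: (@le_trans _ _ ((x ^+ j / j`!%:R) * (expR l%:R * expR (- x)))).
  by rewrite mulrA ler_pM ?mulr_ge0 ?exprn_ge0 ?subr_ge0.
have h3 := @exprn_le_expR R j.+1 x (ltW x0).
have h4 : x ^+ j / j`!%:R * expR (- x) <= l%:R / x.
  rewrite ler_pdivlMr// expRN.
  rewrite [leLHS](_ : _ = x ^+ j.+1 / (j`!%:R * expR x)); last first.
    by rewrite exprS; field; rewrite !gt_eqF ?expR_gt0 ?fact_gt0R.
  rewrite ler_pdivrMr ?mulr_gt0 ?expR_gt0 ?fact_gt0R//.
  apply: le_trans h3 _; rewrite factS natrM -!mulrA.
  by rewrite ler_wpM2r ?mulr_ge0 ?expR_ge0.
rewrite [leLHS](_ : _ = expR l%:R * (x ^+ j / j`!%:R * expR (- x))); last by ring.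
rewrite [leRHS](_ : _ = expR l%:R * (l%:R / x)); last by ring.
by rewrite ler_wpM2l ?expR_ge0.
Qed.

Lemma cvg_sum_ord l (f : nat -> nat -> R) (c : nat -> R) :
  (forall j, f j n @[n --> \oo] --> c j) ->
  \sum_(j < l) f j n @[n --> \oo] --> \sum_(j < l) c j.
Proof.
move=> fc; elim: l => [|l IH].
  by under eq_fun do rewrite big_ord0; rewrite big_ord0; exact: cvg_cst.
by under eq_fun do rewrite big_ord_recr/=; rewrite big_ord_recr/=; exact: cvgD.
Qed.

Section poisson_limit.
Variables (p : nat -> R) (x : R).
Hypothesis p0 : \forall n \near \oo, 0 <= p n.
Hypothesis npx : n%:R * p n @[n --> \oo] --> x.

Lemma cvg_small : p n @[n --> \oo] --> (0 : R).
Proof.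
have h : n%:R^-1 * (n%:R * p n) @[n --> \oo] --> (0 * x : R).
  apply: cvgM => //; apply/gtr0_cvgV0; last exact: cvgr_idn.
  by near=> n; rewrite ltr0n; near: n; exact: nbhs_infty_gt.
rewrite mul0r in h; apply: cvg_trans h; apply: near_eq_cvg; near=> n.
rewrite mulrA mulVf ?mul1r// pnatr_eq0 -lt0n.
by near: n; exact: nbhs_infty_gt.
Unshelve. all: by end_near. Qed.

Lemma cvg_sub_mul j : (n - j)%:R * p n @[n --> \oo] --> x.
Proof.
have h : n%:R * p n - j%:R * p n @[n --> \oo] --> (x - j%:R * 0 : R).
  by apply: cvgB => //; apply: cvgMr; exact: cvg_small.
rewrite mulr0 subr0 in h; apply: cvg_trans h; apply: near_eq_cvg; near=> n.
rewrite -mulrBl -natrB//.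
by near: n; exact: nbhs_infty_ge.
Unshelve. all: by end_near. Qed.

Lemma cvg_ffact_mul j : (n ^_ j)%:R * p n ^+ j @[n --> \oo] --> x ^+ j.
Proof.
elim: j => [|j IH]; first by under eq_fun do rewrite ffactn0 expr0 mulr1; exact: cvg_cst.
have -> : (fun n => (n ^_ j.+1)%:R * p n ^+ j.+1) =
  (fun n => (n ^_ j)%:R * p n ^+ j * ((n - j)%:R * p n)).
  by apply/funext => n; rewrite ffactnSr natrM exprSr; ring.
by rewrite exprSr; exact: cvgM IH (cvg_sub_mul j).
Qed.

(** Squeezed between exp(-n p_n / (1 - p_n)) and exp(-(n - j) p_n), whose exponents both tend to
    -x. *)
Lemma cvg_onem_exp j : (1 - p n) ^+ (n - j) @[n --> \oo] --> expR (- x).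
Proof.
have h1 : expR (- ((n - j)%:R * p n)) @[n --> \oo] --> expR (- x).
  apply: continuous_cvg; first exact: continuous_expR.
  by apply: cvgN; exact: cvg_sub_mul.
have h2 : expR (- (n%:R * (p n / (1 - p n)))) @[n --> \oo] --> expR (- x).
  apply: continuous_cvg; first exact: continuous_expR.
  apply: cvgN; under eq_fun do rewrite mulrA.
  have h : n%:R * p n * (1 - p n)^-1 @[n --> \oo] --> (x * (1 - 0)^-1 : R).
    apply: cvgM => //; apply: cvgV; first by rewrite subr0 oner_neq0.
    by apply: cvgB; [exact: cvg_cst|exact: cvg_small].
  by move: h; rewrite subr0 invr1 mulr1.
apply: (squeeze_cvgr _ h2 h1); near=> n.
have pn0 : 0 <= p n by near: n.
have pn1 : p n < 1 by near: n; apply: (cvgr_lt _ cvg_small); exact: ltr01.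
apply/andP; split; last by apply: onem_exp_le; exact: ltW.
apply: le_trans (onem_exp_ge _ pn1) _.
by apply: ler_wiXn2l; rewrite ?subr_ge0 ?gerBl ?(ltW pn1)// leq_subr.
Unshelve. all: by end_near. Qed.

(** Poisson's limit theorem on each of the l terms, the binomial coefficient being written as a
    falling factorial over j!. *)
Lemma cvg_binomial_defect l :
  binomial_defect l n (p n) @[n --> \oo] --> poisson_defect l x.
Proof.
apply: (@cvg_sum_ord l (fun j n => (l - j)%:R * 'C(n, j)%:R * p n ^+ j * (1 - p n) ^+ (n - j))
  (fun j => (l - j)%:R * (x ^+ j / j`!%:R * expR (- x)))) => j.
have -> : (fun n => (l - j)%:R * 'C(n, j)%:R * p n ^+ j * (1 - p n) ^+ (n - j)) =
   (fun n => (l - j)%:R * ((n ^_ j)%:R * p n ^+ j / j`!%:R * (1 - p n) ^+ (n - j))).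
  by apply/funext => n; rewrite binomial_ffact; ring.
by apply: cvgMr; apply: cvgM (cvg_onem_exp j); apply: cvgMl; exact: cvg_ffact_mul.
Qed.

End poisson_limit.

End defect.

(** * Expectation of the truncated count *)

Section expectation_min.
Local Open Scope ereal_scope.

Lemma measurable_count d (T : measurableType d) (R : realType) (f h : nat -> T -> R) (s : seq nat) :
  (forall m, measurable_fun setT (f m)) -> (forall m, measurable_fun setT (h m)) ->
  measurable_fun setT (fun z => count (fun m => (f m z <= h m z)%R) s).
Proof.
move=> mf mh; elim: s => [|m s IH] /=; first exact: measurable_cst.
apply: measurable_fun_addn => //.
apply: (measurableT_comp (f := nat_of_bool)) => //.
exact: measurable_fun_ler.
Qed.

Lemma measurable_natfun (R : realType) (g : nat -> R) : measurable_fun setT g.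
Proof. by []. Qed.

Context d (T : measurableType d) (R : realType) (P : probability T R).
Variables (X : nat -> T -> R) (n l : nat) (v p : R).
Hypothesis indX : mutually_independent P X.
Hypothesis pX : forall m, P [set w | (v <= X m w)%R] = p%:E.
Hypothesis ln : (l <= n)%N.

Let mX m : measurable_fun setT (X m). Proof. by case: indX. Qed.

Let mcount : measurable_fun setT (count_ge X n v).
Proof.
rewrite /count_ge; under eq_fun do rewrite count_map.
by apply: (measurable_count (f := fun=> cst v)).
Qed.

(** For the count N, min(l, N) + (l - N)^+ = l, the positive part being subtraction in [nat]. Only
    values N < l contribute to the second term, and l <= n places them within the binomial range. *)
Lemma expectation_minn :
  \int[P]_w (minn l (count_ge X n v w))%:R%:E = (l%:R - binomial_defect l n p)%:E.
Proof.
have E : \int[P]_w (minn l (count_ge X n v w))%:R%:E +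
         \int[P]_w (l - count_ge X n v w)%:R%:E = l%:R%:E.
  rewrite -ge0_integralD//; last 2 first.
  - apply/measurable_EFinP.
    exact: (measurableT_comp (measurable_natfun (fun j => (minn l j)%:R)) mcount).
  - apply/measurable_EFinP.
    exact: (measurableT_comp (measurable_natfun (fun j => (l - j)%:R)) mcount).
  transitivity (\int[P]_w (cst l%:R%:E w)).
    apply: eq_integral => w _; rewrite -EFinD -natrD /=; congr (_%:R%:E).
    by rewrite /minn; case: ltnP => h; rewrite ?subnKC// (eqP (ltnW h : (l <= _)%N)) addn0.
  by rewrite integral_cst// -[RHS]mule1; congr (_ * _); exact: probability_setT.
have D := @expectation_count _ T R P X n v p indX pX (fun j => (l - j)%:R) (fun=> ler0n _ _).
rewrite D in E.
have -> : binomial_defect l n p = (\sum_(j < n.+1)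
    (l - j)%:R * 'C(n, j)%:R * p ^+ j * (1 - p) ^+ (n - j))%R.
  rewrite /binomial_defect.
  rewrite (big_ord_widen n.+1 (fun j =>
    (l - j)%:R * 'C(n, j)%:R * p ^+ j * (1 - p) ^+ (n - j))%R); last exact: leqW.
  rewrite big_mkcond; apply: eq_bigr => j _; case: ltnP => // lj.
  by rewrite (eqP lj) !mul0r.
by rewrite EFinB -E addeK.
Qed.

(** Follows from min(l, N) <= N and E[N] = n p, that is from the probabilistic meaning of the sum
    and not from its terms. *)
Lemma minn_defect_le : (l%:R - binomial_defect l n p <= n%:R * p)%R.
Proof.
rewrite -lee_fin -expectation_minn -(@expectation_count_ge _ T R P X n v p indX pX).
apply: ge0_le_integral => //.
- apply/measurable_EFinP.
  exact: (measurableT_comp (measurable_natfun (fun j => (minn l j)%:R)) mcount).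
- apply/measurable_EFinP.
  exact: (measurableT_comp (measurable_natfun (fun j => j%:R)) mcount).
- by move=> w _; rewrite lee_fin ler_nat geq_minr.
Qed.

End expectation_min.

(** * The Gumbel mean *)

Section real_line_ftc.
Local Open Scope ereal_scope.
Variable R : realType.
Notation mu := (@lebesgue_measure R).
Variables f F : R -> R.
Hypotheses (f0 : forall x, (0 <= f x)%R) (cf : continuous f).
Hypothesis dF : forall x, is_derive x (1%R : R) F (f x).

Let cF : continuous F.
Proof.
move=> x; apply: differentiable_continuous; apply/derivable1_diffP.
by have [] := dF x.
Qed.

Lemma ge0_integral_itvcy_is_derive (a l : R) : F x @[x --> +oo%R] --> l ->
  \int[mu]_(x in `[a, +oo[) (f x)%:E = (l - F a)%:E.
Proof.
move=> Fl; apply: ge0_continuous_FTC2y Fl _ _ _ => [x _||x _||x _].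
- exact: f0.
- exact: continuous_subspaceT.
- by have [] := dF x.
- exact/cvg_at_right_filter/cF.
- by rewrite derive1E; exact: derive_val.
Qed.

(** The reflection x |-> -x reduces this to a half-line going to +oo. *)
Lemma ge0_integral_itvNyc_is_derive (a l : R) : F x @[x --> -oo%R] --> l ->
  \int[mu]_(x in `]-oo, a]) (f x)%:E = (F a - l)%:E.
Proof.
move=> /cvgNy_compNP Fl.
rewrite -[a in LHS]opprK ge0_integration_by_substitutionNy//; last first.
  exact: continuous_subspaceT.
have dG (x : R) : is_derive x (1%R : R) (- (F \o -%R))%R (f (- x)).
  have h := dF (- x)%R.
  by apply: is_derive_eq; rewrite /GRing.scale/=; ring.
have cfN : continuous (f \o -%R).
  by move=> x; apply: continuous_comp; [exact: opp_continuous|exact: cf].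
have cG : continuous (- (F \o -%R))%R.
  move=> x; apply: differentiable_continuous; apply/derivable1_diffP.
  by have [] := dG x.
have -> : (F a - l = (- l) - (- (F \o -%R)) (- a))%R by rewrite !fctE/= !opprK addrC.
apply: ge0_continuous_FTC2y => [x _|||x _||x _].
- exact: f0.
- exact: continuous_subspaceT.
- exact: cvgN.
- by have [] := dG x.
- exact/cvg_at_right_filter/cG.
- by rewrite derive1E; exact: derive_val.
Qed.

Lemma ge0_integralT_is_derive (l1 l2 : R) :
  F x @[x --> -oo%R] --> l1 -> F x @[x --> +oo%R] --> l2 ->
  \int[mu]_x (f x)%:E = (l2 - l1)%:E.
Proof.
move=> h1 h2.
have mf : measurable_fun setT (EFin \o f).
  by apply/measurable_EFinP; exact: continuous_measurable_fun.
have T : [set: R] = `]-oo, 0%R] `|` `]0%R, +oo[.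
  by apply/seteqP; split => // x _ /=; rewrite !in_itv/= andbT; case: (leP x 0%R); [left|right].
rewrite T (ge0_integral_setU mu)//; last 3 first.
- exact: measurable_funTS.
- by move=> x _; rewrite lee_fin.
- apply/disj_setPS => x [] /=; rewrite !in_itv/= andbT => x0.
  by rewrite ltNge x0.
rewrite integral_itv_obnd_cbnd; last exact: measurable_funTS.
rewrite (ge0_integral_itvNyc_is_derive _ h1) (ge0_integral_itvcy_is_derive _ h2).
by rewrite -EFinD; congr (_%:E); ring.
Qed.

End real_line_ftc.

Section gumbel.
Local Open Scope ereal_scope.
Variable R : realType.
Notation mu := (@lebesgue_measure R).
Notation mR := (measurableTypeR R).

Lemma cvg_expRN_half : expR (- (x / 2)) @[x --> +oo%R] --> (0%R : R).
Proof.
apply: (cvg_comp (fun x : R => x / 2)%R (fun x => expR (- x)) _ (@cvgr_expR R)).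
by apply: gt0_cvgMly; [rewrite invr_gt0|exact: cvg_id].
Qed.

(* The limit law of the normalized (k+1)-st largest value. *)
Definition gumbel_cdf (k : nat) (u : R) : R := erlang_tail k.+1 (expR (- u)).
Definition gumbel_pdf (k : nat) (u : R) : R :=
  (expR (- expR (- u)) * (expR (- u) ^+ k.+1 / k`!%:R))%R.

Lemma gumbel_pdf_ge0 k u : (0 <= gumbel_pdf k u)%R.
Proof. by rewrite mulr_ge0 ?divr_ge0 ?exprn_ge0 ?expR_ge0. Qed.

Lemma continuous_gumbel_pdf k : continuous (gumbel_pdf k).
Proof.
move=> u; apply: cvgM.
  apply: continuous_cvg; first exact: continuous_expR.
  by apply: cvgN; exact: continuous_expRN.
apply: cvgMl.
exact: (cvg_comp (fun u => expR (- u)) (fun x : R => x ^+ k.+1)%R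
  (@continuous_expRN R u) (@exprn_continuous R k.+1 (expR (- u)))).
Qed.

Lemma is_derive_gumbel_cdf k u :
  is_derive u (1%R : R) (gumbel_cdf k) (gumbel_pdf k u).
Proof.
have h1 := is_derive_expRN u.
have h2 := is_derive_erlang_tail k (expR (- u)).
have -> : gumbel_cdf k = erlang_tail k.+1 \o (expR \o -%R) by [].
apply: is_derive_eq.
by rewrite /GRing.scale /= /gumbel_pdf exprSr; ring.
Qed.

Lemma gumbel_cdf_cvgy k : gumbel_cdf k u @[u --> +oo%R] --> (1%R : R).
Proof.
rewrite -[X in _ --> X](@erlang_tail_at0 R k.+1 isT).
exact: (cvg_comp (fun x : R => expR (- x)) (@erlang_tail R k.+1) (@cvgr_expR R)
  (@continuous_erlang_tail R k.+1 0%R)).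
Qed.

Lemma gumbel_cdf_cvgNy k : gumbel_cdf k u @[u --> -oo%R] --> (0%R : R).
Proof.
apply/cvgNy_compNP.
have h : (2 ^+ k.+1 * expR (- (x / 2)))%R @[x --> +oo%R] --> (0%R : R).
  by rewrite -[X in _ --> X](mulr0 (2 ^+ k.+1)%R); apply: cvgMr; exact: cvg_expRN_half.
apply: (@squeeze_cvgr _ _ _ _ (cst 0%R) (fun x => 2 ^+ k.+1 * expR (- (x / 2)))%R) => //.
  near=> x; rewrite /gumbel_cdf /= opprK erlang_tail_ge0 ?expR_ge0//=.
  apply: le_trans (erlang_tail_le_half _ (expR_ge0 _)) _.
  rewrite ler_wpM2l ?exprn_ge0// ler_expR lerN2 ler_wpM2r ?invr_ge0//.
  by apply: le_trans (expR_ge1Dx _); rewrite lerDr.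
exact: cvg_cst.
Unshelve. all: by end_near. Qed.

Lemma integral_gumbel_pdf k : \int[mu]_u (gumbel_pdf k u)%:E = 1.
Proof.
rewrite (ge0_integralT_is_derive (gumbel_pdf_ge0 k) (@continuous_gumbel_pdf k)
  (is_derive_gumbel_cdf k) (gumbel_cdf_cvgNy k) (gumbel_cdf_cvgy k)).
by rewrite subr0.
Qed.

Lemma gumbel_cdf0E u : gumbel_cdf 0 u = expR (- expR (- u)).
Proof.
by rewrite /gumbel_cdf /erlang_tail /expsum big_ord1 expr0 fact0 divr1 mulr1.
Qed.

Lemma gumbel_cdf0_gt0 u : (0 < gumbel_cdf 0 u)%R.
Proof. by rewrite gumbel_cdf0E expR_gt0. Qed.

Lemma gumbel_cdf0_lt1 u : (gumbel_cdf 0 u < 1)%R.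
Proof. by rewrite gumbel_cdf0E expR_lt1 oppr_lt0 expR_gt0. Qed.

Lemma continuous_gumbel_cdf k : continuous (gumbel_cdf k).
Proof.
move=> x; apply: differentiable_continuous; apply/derivable1_diffP.
by have [] := is_derive_gumbel_cdf k x.
Qed.

(** Tonelli in the form suited to a mean: |x| is the length of a set of levels, and [D] selects the
    positive or the negative ones. *)
Lemma integral_layer_density (A : set (mR * mR)) (D : set R) (g : R -> R) :
  measurable A -> measurable D -> measurable_fun setT g -> (forall x, 0 <= g x)%R ->
  \int[mu]_x (mu ([set v | A (x, v)] `&` D) * (g x)%:E) =
  \int[mu]_(v in D) \int[mu]_(x in [set x | A (x, v)]) (g x)%:E.
Proof.
move=> mA mD mg g0.
pose F (z : mR * mR) : \bar R := (\1_A z * (\1_D (z.2 : R) * g z.1))%:E.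
have mF : measurable_fun setT F.
  apply/measurable_EFinP; apply: measurable_funM => //.
  apply: measurable_funM; last exact: measurableT_comp.
  by apply: (measurableT_comp (f := \1_D : R -> R)) => //; exact: measurable_snd.
have F0 z : 0 <= F z by rewrite lee_fin !mulr_ge0.
have sec1 x : measurable [set v : mR | A (x, v)].
  rewrite -[X in measurable X]setTI.
  exact: (@measurable_pair1 _ _ mR mR x measurableT A mA).
have sec2 v : measurable [set x : mR | A (x, v)].
  rewrite -[X in measurable X]setTI.
  exact: (@measurable_pair2 _ _ mR mR v measurableT A mA).
transitivity (\int[mu]_x \int[mu]_v F (x, v)).
  apply: eq_integral => x _; rewrite /F.
  transitivity (\int[mu]_v ((g x)%:E * (\1_([set v : mR | A (x, v)] `&` D) v)%:E)).
    rewrite ge0_integralZl//; last 2 first.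
    - by apply/measurable_EFinP; apply: measurable_indic; exact: measurableI.
    - by rewrite lee_fin.
    rewrite muleC; congr (_ * _); apply/esym/integral_indicT.
    exact: measurableI.
  apply: eq_integral => v _; rewrite -EFinM indicI /=; congr (_%:E).
  have -> : \1_[set v0 : mR | A (x, v0)] v = \1_A (x, v) :> R by [].
  by ring.
rewrite (fubini_tonelli F mF F0) [RHS]integral_mkcond.
apply: eq_integral => v _; rewrite patchE.
case: ifPn => vD; last first.
  by rewrite integral0_eq// => x _; rewrite /F /= !indicE (negbTE vD) mul0r mulr0.
rewrite [RHS]integral_mkcond; apply: eq_integral => x _.
rewrite patchE /F /= !indicE vD mul1r.
have -> : ((x, v) \in A) = (x \in [set x | A (x, v)]) by [].
by case: ifPn => _; rewrite ?mul1r ?mul0r.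
Qed.

Definition gumbel_excess (u : R) : R := (\1_`]0%R, +oo[ u - gumbel_cdf 0 u)%R.

(** The positive part of x is the length of ]0, x] and its negative part that of ]x, 0]; exchanging
    integrals yields the upper tail on u > 0 and the lower tail on u <= 0. Treating the parts
    separately lets Tonelli apply before integrability is known. *)
Lemma gumbel_meanE : gumbel_mean R = \int[mu]_u (gumbel_excess u)%:E.
Proof.
have gE x : (x * (expR (- x) * expR (- expR (- x))))%R = (x * gumbel_pdf 0 x)%R.
  by rewrite /gumbel_pdf expr1 fact0 divr1 [(expR (- x) * _)%R]mulrC.
rewrite /gumbel_mean; under eq_integral do rewrite gE.
have mg : measurable_fun setT (gumbel_pdf 0).
  exact: continuous_measurable_fun (@continuous_gumbel_pdf 0).
rewrite integralE [RHS]integralE; congr (_ - _).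
- pose A : set (mR * mR) := [set z | (z.2 : R) <= z.1]%R.
  have mA : measurable A.
    by apply: measurable_set_ler; [exact: measurable_snd|exact: measurable_fst].
  transitivity (\int[mu]_x (mu ([set v : R | A (x, v)] `&` `]0%R, +oo[) * (gumbel_pdf 0 x)%:E)).
    apply: eq_integral => x _; rewrite funeposE.
    have -> : [set v : R | A (x, v)] `&` `]0%R, +oo[ = `]0%R, x]%classic.
      apply/seteqP; split => v /=; rewrite /A /= !in_itv/= andbT.
        by move=> [vx v0]; rewrite v0 vx.
      by move=> /andP[v0 vx].
    rewrite lebesgue_measure_itv/= lte_fin oppr0 adde0.
    have g0 := gumbel_pdf_ge0 0 x.
    case: ltP => x0; first by rewrite -EFinM; apply/max_idPl; rewrite lee_fin mulr_ge0// ltW.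
    by rewrite mul0e; apply/max_idPr; rewrite lee_fin mulr_le0_ge0.
  rewrite integral_layer_density//; last exact: gumbel_pdf_ge0.
  rewrite [LHS]integral_mkcond; apply: eq_integral => v _; rewrite patchE funeposE /gumbel_excess.
  rewrite indicE mem_setE in_itv/= andbT.
  case: ifPn => v0 /=.
    have -> : [set x : R | A (x, v)] = `[v, +oo[%classic.
      by apply/seteqP; split => x /=; rewrite /A /= in_itv/= andbT.
    rewrite (ge0_integral_itvcy_is_derive (gumbel_pdf_ge0 0) (@continuous_gumbel_pdf 0)
      (is_derive_gumbel_cdf 0) _ (gumbel_cdf_cvgy 0)).
    by apply/esym/max_idPl; rewrite lee_fin subr_ge0 ltW ?gumbel_cdf0_lt1.
  by apply/esym/max_idPr; rewrite lee_fin sub0r oppr_le0 ltW ?gumbel_cdf0_gt0.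
- pose A : set (mR * mR) := [set z | (z.1 : R) < z.2]%R.
  have mA : measurable A.
    by apply: measurable_set_ltr; [exact: measurable_fst|exact: measurable_snd].
  transitivity (\int[mu]_x (mu ([set v : R | A (x, v)] `&` `]-oo, 0%R]) * (gumbel_pdf 0 x)%:E)).
    apply: eq_integral => x _; rewrite funenegE.
    have -> : [set v : R | A (x, v)] `&` `]-oo, 0%R] = `]x, 0%R]%classic.
      by apply/seteqP; split => v /=; rewrite /A /= !in_itv/= => /andP.
    rewrite lebesgue_measure_itv/= lte_fin add0e.
    have g0 := gumbel_pdf_ge0 0 x.
    case: ltP => x0.
      rewrite -EFinM mulNr; apply/max_idPl; rewrite lee_fin oppr_ge0.
      by rewrite mulr_le0_ge0// ltW.
    by rewrite mul0e; apply/max_idPr; rewrite lee_fin oppr_le0 mulr_ge0.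
  rewrite integral_layer_density//; last exact: gumbel_pdf_ge0.
  rewrite [LHS]integral_mkcond; apply: eq_integral => v _; rewrite patchE funenegE /gumbel_excess.
  rewrite indicE !mem_setE !in_itv/= andbT.
  case: leP => v0 /=.
    have -> : [set x : R | A (x, v)] = `]-oo, v[%classic.
      by apply/seteqP; split => x /=; rewrite /A /= in_itv/=.
    rewrite integral_itv_bndo_bndc; last by apply/measurable_EFinP; exact: measurable_funTS.
    rewrite (ge0_integral_itvNyc_is_derive (gumbel_pdf_ge0 0) (@continuous_gumbel_pdf 0)
      (is_derive_gumbel_cdf 0) _ (gumbel_cdf_cvgNy 0)).
    rewrite subr0 sub0r opprK; apply/esym/max_idPl.
    by rewrite lee_fin ltW ?gumbel_cdf0_gt0.
  by apply/esym/max_idPr; rewrite lee_fin opprB subr_le0 ltW ?gumbel_cdf0_lt1.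
Qed.

Definition envelope (u : R) : R := expR (- (`|u| / 2)).

Lemma continuous_envelope : continuous envelope.
Proof.
move=> u; apply: continuous_cvg; first exact: continuous_expR.
by apply: cvgN; apply: cvgMl; exact: norm_continuous.
Qed.

Lemma integrable_envelope : mu.-integrable setT (EFin \o envelope).
Proof.
apply/integrableP; split.
  by apply/measurable_EFinP; exact: continuous_measurable_fun continuous_envelope.
under eq_integral do rewrite /= ger0_norm ?expR_ge0//.
rewrite ge0_symfun_integralT; last 3 first.
- by move=> x; exact: expR_ge0.
- exact: continuous_envelope.
- by move=> x; rewrite /envelope /= normrN.
have dF (x : R) : is_derive x (1%R : R)
    (fun y => - 2 * expR (- (y / 2)))%R (expR (- (x / 2))).
  have -> : (fun y => - 2 * expR (- (y / 2)))%R =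
     ((- 2) *: (expR \o (fun y => - (y * 2^-1))))%R :> (R -> R) by [].
  by apply: is_derive_eq; rewrite /GRing.scale/=; field.
have cf : continuous (fun x : R => expR (- (x / 2))).
  move=> u; apply: continuous_cvg; first exact: continuous_expR.
  by apply: cvgN; apply: cvgMl; exact: cvg_id.
have cvg0 : (- 2 * expR (- (x / 2)))%R @[x --> +oo%R] --> (0%R : R).
  by rewrite -[X in _ --> X](mulr0 (- 2)%R); apply: cvgMr; exact: cvg_expRN_half.
rewrite (_ : \int[mu]_(x in _) _ = 2%:E) -?EFinM ?ltry//.
rewrite -set_itvcy.
rewrite -[RHS](_ : (0 - (- 2 * expR (- (0 / 2))))%R%:E = 2%:E); last first.
  by rewrite mul0r oppr0 expR0; congr (_%:E); ring.
rewrite -(ge0_integral_itvcy_is_derive (fun x => expR_ge0 _) cf dF 0%R cvg0).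
apply: eq_integral => x; rewrite inE/= in_itv/= andbT => x0.
by rewrite /envelope ger0_norm.
Qed.

End gumbel.

(** * The limit of the integrals *)

Section limit_integral.
Local Open Scope ereal_scope.
Variable R : realType.
Notation mu := (@lebesgue_measure R).

(** For u > 0, 1 - exp(-y) <= y at y = exp(-u); for u <= 0, exp(-u) >= 1 - u >= -u/2. *)
Lemma gumbel_excess_le_envelope (u : R) : (`|gumbel_excess u| <= envelope u)%R.
Proof.
rewrite /gumbel_excess /envelope indicE mem_setE in_itv/= andbT gumbel_cdf0E.
case: ltP => u0 /=.
  rewrite ger0_norm ?subr_ge0; last by rewrite ltW// expR_lt1 oppr_lt0 expR_gt0.
  rewrite gtr0_norm//; apply: (@le_trans _ _ (expR (- u))).
    by rewrite lerBlDl -lerBlDr; exact: expR_ge1Dx.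
  by rewrite ler_expR lerN2; lra.
rewrite sub0r normrN ger0_norm ?expR_ge0// ler0_norm// ler_expR.
rewrite lerN2; apply: le_trans (expR_ge1Dx _); lra.
Qed.

Lemma measurable_gumbel_excess : measurable_fun setT (@gumbel_excess R).
Proof.
apply: measurable_funB => //.
exact: continuous_measurable_fun (@continuous_gumbel_cdf R 0).
Qed.

Lemma integrable_gumbel_excess : mu.-integrable setT (EFin \o @gumbel_excess R).
Proof.
apply: le_integrable (@integrable_envelope R) => //.
  by apply/measurable_EFinP; exact: measurable_gumbel_excess.
move=> u _ /=; rewrite lee_fin (ger0_norm (expR_ge0 _)).
exact: gumbel_excess_le_envelope.
Qed.

Lemma integrable_gumbel_pdf k : mu.-integrable setT (EFin \o @gumbel_pdf R k).
Proof.
apply/integrableP; split.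
  apply/measurable_EFinP.
  exact: continuous_measurable_fun (@continuous_gumbel_pdf R k).
under eq_integral do rewrite /= ger0_norm ?gumbel_pdf_ge0//.
by rewrite integral_gumbel_pdf ltry.
Qed.

Definition limit_excess (l : nat) (u : R) : R :=
  (l%:R * \1_`]0%R, +oo[ u - poisson_defect l (expR (- u)))%R.

(** The Poisson term j = 0 is m + 1 times the Gumbel distribution function. With x = exp(-u), the
    term j = k + 1 has x^(k+1) / (k+1)! exp(-x), which is [gumbel_pdf k u] divided by k + 1. *)
Lemma limit_excessE m u : limit_excess m.+1 u =
  (m.+1%:R * gumbel_excess u -
   \sum_(k < m) (m - k)%:R / k.+1%:R * gumbel_pdf k u)%R.
Proof.
rewrite /limit_excess /poisson_defect big_ord_recl /= subn0 expr0 fact0 divr1 mul1r.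
rewrite /gumbel_excess gumbel_cdf0E mulrBr opprD addrA; congr (_ - _)%R.
apply: eq_bigr => k _; rewrite /bump /= add1n subSS -[RHS]mulrA; congr (_ * _)%R.
rewrite /gumbel_pdf factS natrM.
have h1 := fact_gt0R R k; have h2 : (0 < k.+1%:R :> R)%R by rewrite ltr0n.
by move: (k.+1%:R)%R h2 => c c0; field; rewrite !gt_eqF.
Qed.

(** Use m - k = (m + 1) - (k + 1); the last term of the harmonic sum, times m + 1, supplies the 1 by
    which m + 1 and m differ. *)
Lemma harmonic_defect m :
  (\sum_(k < m) (m - k)%:R / k.+1%:R =
   m.+1%:R * (\sum_(1 <= k < m.+2) k%:R^-1 - 1) :> R)%R.
Proof.
rewrite big_add1 /= big_mkord big_ord_recr /= mulrBr mulr1 mulrDr mulfV ?pnatr_eq0//.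
rewrite mulr_sumr.
transitivity (\sum_(k < m) (m.+1%:R / k.+1%:R) - \sum_(k < m) 1 : R)%R; last first.
  rewrite sumr_const card_ord -[X in (_ - X = _)%R](addrK 1%R) natr1; ring.
rewrite -sumrB; apply: eq_bigr => k _.
have h2 : (k.+1%:R != 0 :> R)%R by rewrite pnatr_eq0.
have -> : ((m - k)%:R = m.+1%:R - k.+1%:R :> R)%R.
  by rewrite -natrB ?subSS// ltnS ltnW.
by rewrite mulrBl mulfV.
Qed.

Lemma integral_limit_excess m : \int[mu]_u (limit_excess m.+1 u)%:E =
  m.+1%:R%:E * (gumbel_mean R + (1 - \sum_(1 <= k < m.+2) k%:R^-1)%:E).
Proof.
have i1 : mu.-integrable setT (fun u => m.+1%:R%:E * (gumbel_excess u)%:E).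
  by apply: integrableZl => //; exact: integrable_gumbel_excess.
have i2 k : mu.-integrable setT
    (fun u => ((m - k)%:R / k.+1%:R)%R%:E * (gumbel_pdf k u)%:E).
  by apply: integrableZl => //; exact: integrable_gumbel_pdf.
transitivity (\int[mu]_u (m.+1%:R%:E * (gumbel_excess u)%:E -
    \sum_(k < m) (((m - k)%:R / k.+1%:R)%R%:E * (gumbel_pdf k u)%:E))).
  apply: eq_integral => u _; rewrite limit_excessE EFinB EFinM; congr (_ - _).
  by rewrite -sumEFin; apply: eq_bigr => k _; rewrite EFinM.
rewrite integralB//; last first.
  by apply: integrable_sum => // k _; exact: i2.
rewrite integralZl//; last exact: integrable_gumbel_excess.
rewrite -gumbel_meanE integral_sum//.
(* Finiteness of the mean justifies distributing the product over a sum of extended reals. *)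
have fin : gumbel_mean R \is a fin_num.
  by rewrite gumbel_meanE; apply: integrable_fin_num => //; exact: integrable_gumbel_excess.
have -> (c : R) : m.+1%:R%:E * (gumbel_mean R + c%:E) =
    m.+1%:R%:E * gumbel_mean R + (m.+1%:R * c)%:E.
  by rewrite -(fineK fin) -EFinD -!EFinM -EFinD mulrDr.
congr (_ + _).
rewrite (eq_bigr (fun k : 'I_m => ((m - k)%:R / k.+1%:R)%R%:E)); last first.
  move=> k _; rewrite integralZl//; last exact: integrable_gumbel_pdf.
  by rewrite integral_gumbel_pdf mule1.
by rewrite sumEFin harmonic_defect -EFinN -mulrN opprB.
Qed.

Section sequence.
Variables (L : nat) (L0 : (0 < L)%N) (l : nat) (a : nat -> R).
Hypothesis a_quantile : forall n, (1 < n)%N ->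
  (0 < a n)%R /\ (erlang_tail L (a n) = n%:R^-1)%R.
Hypothesis defect_bounds : forall (n : nat) (t : R), (l <= n)%N -> (0 < t)%R ->
  (0 <= l%:R - binomial_defect l n (erlang_tail L t) <= n%:R * erlang_tail L t)%R.

Let b n := b_of L (a n).
Let pt n u : R := (a n + b n * u)%R.
Let p n u : R := erlang_tail L (pt n u).

(* The integrand of \int_0^oo E[min(l, #{m : t <= X_m})] dt after t = a n + b n * u, minus
   the constant [l] over [- a n / b n < u <= 0]: this second part integrates to [l * a n / b n]. *)
Definition rescaled_excess n u : R :=
  (\1_`]0%R, +oo[ (pt n u) * (l%:R * \1_`]0%R, +oo[ u - binomial_defect l n (p n u)))%R.

Let Cst : R := (2 ^+ L * (1 + l%:R ^+ 3 * expR l%:R))%R.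

(** On u > 0 the truncated expectation is at most n p; on u <= 0 [binomial_defect_le] applies. Since
    b_n >= 1, replacing b_n u by u only weakens the exponential bounds. In [Cst] the summand 1
    serves the first case and l^3 exp(l) the second. *)
Lemma rescaled_excess_le n u : (1 < n)%N -> (l <= n)%N ->
  (`|rescaled_excess n u| <= Cst * envelope u)%R.
Proof.
move=> n1 ln; have [an0 anE] := a_quantile n1.
have n0 : (0 < n%:R :> R)%R by rewrite ltr0n ltnW.
have K0 : (0 <= l%:R ^+ 3 * expR l%:R :> R)%R by rewrite mulr_ge0 ?exprn_ge0 ?expR_ge0.
have C0 : (0 <= Cst)%R by rewrite mulr_ge0 ?exprn_ge0 ?addr_ge0.
have b1 : (1 <= b n)%R by apply: b_of_ge1 => //; exact: ltW.
rewrite /rescaled_excess [X in (X * _)%R]indicE mem_setE in_itv/= andbT.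
case: ltP => t0 /=; last by rewrite mul0r normr0 mulr_ge0 ?expR_ge0.
rewrite mul1r.
have p0 : (0 < p n u)%R by apply: erlang_tail_gt0 => //; exact: ltW.
have p1 : (p n u <= 1)%R by rewrite ltW// erlang_tail_lt1.
have /andP[lo hi] := defect_bounds ln t0.
rewrite indicE mem_setE in_itv/= andbT /envelope; case: ltP => u0 /=.
  rewrite mulr1 ger0_norm// gtr0_norm//; apply: le_trans hi _.
  have bu0 : (0 <= b n * u)%R by rewrite mulr_ge0 ?(le_trans ler01 b1)// ltW.
  apply: (@le_trans _ _ (2 ^+ L * expR (- (u / 2)))%R); last first.
    by rewrite ler_wpM2r ?expR_ge0// ler_peMr ?exprn_ge0// lerDl.
  apply: (@le_trans _ _ (n%:R * (erlang_tail L (a n) * erlang_tail L (b n * u)))%R).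
    by rewrite ler_wpM2l ?(ltW n0)//; apply: erlang_tailD_le => //; exact: ltW.
  rewrite anE mulrA mulfV ?gt_eqF// mul1r.
  apply: le_trans (erlang_tail_le_half _ bu0) _.
  rewrite ler_wpM2l ?exprn_ge0// ler_expR lerN2 ler_wpM2r ?invr_ge0//.
  by rewrite ler_peMl// ltW.
rewrite mulr0 sub0r normrN.
rewrite (ger0_norm (binomial_defect_ge0 _ _ (ltW p0) p1)) (ler0_norm u0).
have np0 : (0 < n%:R * p n u)%R by rewrite mulr_gt0.
apply: le_trans (binomial_defect_le _ (ltW p0) p1 np0) _.
have v0 : (0 <= - (b n * u))%R.
  by rewrite oppr_ge0 mulr_ge0_le0// (le_trans ler01 b1).
(* Submultiplicativity from the level a_n + b_n u up to a_n, where the tail is 1/n: a lower bound on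
   n p. *)
have h : (1 <= n%:R * p n u * (2 ^+ L * expR (- (- u / 2))))%R.
  have := erlang_tailD_le L (ltW t0) v0; rewrite /pt addrK anE => h.
  rewrite -(ler_pM2l n0) mulfV ?gt_eqF// in h.
  rewrite mulrA in h.
  apply: (le_trans h); apply: ler_wpM2l; first exact: ltW.
  apply: le_trans (erlang_tail_le_half _ v0) _.
  rewrite ler_wpM2l ?exprn_ge0// ler_expR lerN2 ler_wpM2r ?invr_ge0//.
  by rewrite -mulrN ler_peMl// oppr_ge0.
rewrite ler_pdivrMr//.
apply: (@le_trans _ _ ((l%:R ^+ 3 * expR l%:R) *
  (n%:R * p n u * (2 ^+ L * expR (- (- u / 2)))))%R).
  by rewrite ler_peMr.
rewrite /Cst [leRHS](_ : _ = (1 + l%:R ^+ 3 * expR l%:R) *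
  (n%:R * p n u * (2 ^+ L * expR (- (- u / 2)))))%R; last by ring.
rewrite ler_wpM2r ?lerDr//.
exact: le_trans ler01 h.
Qed.

Lemma measurable_binomial_defect n : measurable_fun setT (@binomial_defect R l n).
Proof.
rewrite /binomial_defect; apply: measurable_sum => j.
apply: measurable_funM.
  by apply: measurable_funM => //; exact: measurable_funX.
by apply: measurable_funX; exact: measurable_funB.
Qed.

Lemma measurable_rescaled_excess n : measurable_fun setT (rescaled_excess n).
Proof.
have mpt : measurable_fun setT (pt n).
  by apply: measurable_funD => //; exact: measurable_funM.
apply: measurable_funM.
  by apply: (measurableT_comp (f := \1_`]0%R, +oo[ : R -> R)).
apply: measurable_funB; first exact: measurable_funM.
apply: (measurableT_comp (measurable_binomial_defect n)).
apply: measurableT_comp mpt.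
exact: continuous_measurable_fun (@continuous_erlang_tail R L).
Qed.

Lemma integrable_rescaled_excess n : (1 < n)%N -> (l <= n)%N ->
  mu.-integrable setT (EFin \o rescaled_excess n).
Proof.
move=> n1 ln.
have iE : mu.-integrable setT (fun u => Cst%:E * (envelope u)%:E).
  by apply: integrableZl => //; exact: integrable_envelope.
apply: le_integrable iE => //.
  by apply/measurable_EFinP; exact: measurable_rescaled_excess.
move=> u _ /=; rewrite lee_fin; apply: le_trans (rescaled_excess_le u n1 ln) _.
exact: ler_norm.
Qed.

(** As p(a_n) = 1/n, n p is the ratio in [erlang_tail_ratio_cvg]; since a_n tends to +oo, the
    cut-off at level 0 is eventually inactive for fixed u. *)
Lemma rescaled_excess_cvg u : rescaled_excess n u @[n --> \oo] --> limit_excess l u.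
Proof.
have ay := quantile_cvgy L0 a_quantile.
have b1 : b n @[n --> \oo] --> (1%R : R) by exact: b_of_cvg.
have npx : (n%:R * p n u)%R @[n --> \oo] --> expR (- u).
  have h := erlang_tail_ratio_cvg L0 (u := u) ay b1.
  apply: cvg_trans h; apply: near_eq_cvg; near=> n.
  have n1 : (1 < n)%N by near: n; exact: nbhs_infty_gt.
  by have [_ ->] := a_quantile n1; rewrite invrK mulrC.
have ptpos : \forall n \near \oo, (0 < pt n u)%R.
  have bu : (b n * u)%R @[n --> \oo] --> u.
    by rewrite -[X in _ --> X]mul1r; apply: cvgMl.
  near=> n; rewrite /pt -ltrBlDr sub0r.
  apply: (@lt_trans _ _ (- (u - 1))%R).
    by rewrite ltrN2; near: n; apply: (cvgr_gt _ bu); rewrite gtrBl.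
  by near: n; move/cvgryPgt : ay; exact.
have p0 : \forall n \near \oo, (0 <= p n u)%R.
  near=> n; apply: erlang_tail_ge0; apply: ltW; near: n; exact: ptpos.
have h : (l%:R * \1_`]0%R, +oo[ u - binomial_defect l n (p n u))%R @[n --> \oo] -->
    limit_excess l u.
  by apply: cvgB; [exact: cvg_cst|exact: cvg_binomial_defect].
apply: cvg_trans h; apply: near_eq_cvg; near=> n.
rewrite /rescaled_excess [X in _ = (X * _)%R]indicE mem_setE in_itv/= andbT.
have -> : (0 < pt n u)%R by near: n; exact: ptpos.
by rewrite mul1r.
Unshelve. all: by end_near. Qed.

Lemma integral_rescaled_excess_cvg :
  \int[mu]_u (rescaled_excess n u)%:E @[n --> \oo] --> \int[mu]_u (limit_excess l u)%:E.
Proof.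
pose N := maxn 2 l.
(* The domination is available from n = max(2, l) on; the earlier terms are set to 0, which leaves
   the limit unchanged. *)
pose f n u : \bar R := (if (N <= n)%N then rescaled_excess n u else 0%R)%:E.
have big n : (N <= n)%N -> (1 < n)%N /\ (l <= n)%N by rewrite geq_max => /andP.
have mf n : measurable_fun setT (f n).
  rewrite /f; case: (N <= n)%N => //; apply/measurable_EFinP.
  exact: measurable_rescaled_excess.
have ml : measurable_fun setT (fun u => (limit_excess l u)%:E).
  apply/measurable_EFinP; apply: measurable_funB; first exact: measurable_funM.
  apply: measurable_sum => j; apply: measurable_funM => //.
  apply: measurable_funM.
    apply: measurable_funM => //; apply: measurable_funX.
    exact: continuous_measurable_fun (@continuous_expRN R).
  apply: (measurableT_comp (continuous_measurable_fun (@continuous_expRN R))).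
  exact: continuous_measurable_fun (@continuous_expRN R).
have iE : mu.-integrable setT (fun u => Cst%:E * (envelope u)%:E).
  by apply: integrableZl => //; exact: integrable_envelope.
have Cst0 : (0 <= Cst)%R.
  by rewrite mulr_ge0 ?exprn_ge0// addr_ge0// mulr_ge0 ?exprn_ge0 ?expR_ge0.
have ff : {ae mu, forall u, setT u -> f ^~ u @ \oo --> (limit_excess l u)%:E}.
  apply: aeW => u _.
  have h1 : (rescaled_excess n u)%:E @[n --> \oo] --> (limit_excess l u)%:E.
    by apply: cvg_EFin; [exact: nearW|exact: rescaled_excess_cvg].
  apply: cvg_trans h1; apply: near_eq_cvg; near=> n.
  by rewrite /f ifT//; near: n; exact: nbhs_infty_ge.
have fg : {ae mu, forall u n, setT u -> `|f n u| <= Cst%:E * (envelope u)%:E}.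
  apply: aeW => u n _; rewrite /f; case: ifPn => [/big[n1 ln]|_].
    by rewrite lee_fin; exact: rescaled_excess_le.
  by rewrite lee_fin normr0 mulr_ge0// expR_ge0.
have [_ _ h] := @dominated_convergence _ _ _ mu setT measurableT f _ _ mf ml ff iE fg.
apply: cvg_trans h; apply: near_eq_cvg; near=> n.
apply: eq_integral => u _; rewrite /f ifT//; near: n; exact: nbhs_infty_ge.
Unshelve. all: by end_near. Qed.

End sequence.

End limit_integral.

(** * Expectation of the normalized sum *)

Section largest_expectation.
Local Open Scope ereal_scope.
Context d (T : measurableType d) (R : realType) (P : probability T R).
Notation mu := (@lebesgue_measure R).
Variables (X : nat -> T -> R) (f : R -> R) (n l : nat).
Hypothesis indX : mutually_independent P X.
Hypothesis X0 : forall m w, (0 <= X m w)%R.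
Hypothesis fX : forall m v, (0 < v)%R -> P [set w | (v <= X m w)%R] = (f v)%:E.
Hypothesis ln : (l <= n)%N.

Let mX m : measurable_fun setT (X m). Proof. by case: indX. Qed.

Let layer (q : T * measurableTypeR R) : \bar R :=
  (\1_`]0%R, +oo[ q.2 * (minn l (count_ge X n q.2 q.1))%:R)%:E.

Let layer_ge0 q : 0 <= layer q.
Proof. by rewrite lee_fin mulr_ge0// indicE. Qed.

Let measurable_layer : measurable_fun setT layer.
Proof.
apply/measurable_EFinP; apply: measurable_funM.
  apply: (measurableT_comp (f := \1_`]0%R, +oo[ : measurableTypeR R -> R)) => //.
have mc : measurable_fun setT (fun q : T * measurableTypeR R => count_ge X n q.2 q.1).
  rewrite /count_ge; under eq_fun do rewrite count_map.
  apply: (@measurable_count _ _ R (fun _ q => q.2) (fun m q => X m q.1)) => m.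
    exact: measurable_snd.
  exact: measurableT_comp (mX m) (@measurable_fst _ _ _ _).
exact: (measurableT_comp (measurable_natfun (fun j => (minn l j)%:R)) mc).
Qed.

Let sum_largestE w : (sum_largest l [seq X m w | m <- iota 0 n])%:E =
  \int[mu]_v layer (w, v).
Proof.
by rewrite sum_largest_layer//; apply/allP => x /mapP[m _ ->]; exact: X0.
Qed.

(** Measurability comes from the layer integral, a partial integral of a jointly measurable
    function, so the sorting is not analysed. *)
Lemma measurable_sum_largest :
  measurable_fun setT (fun w => sum_largest l [seq X m w | m <- iota 0 n]).
Proof.
apply/measurable_EFinP.
apply: (eq_measurable_fun (fubini_F mu layer)) => [w _|].
  by rewrite /= sum_largestE.
exact: (measurable_fun_fubini_tonelli_F (m2 := mu) (fun q => layer q) measurable_layer).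
Qed.

Lemma expectation_sum_largest :
  \int[P]_w (sum_largest l [seq X m w | m <- iota 0 n])%:E =
  \int[mu]_v (\1_`]0%R, +oo[ v * (l%:R - binomial_defect l n (f v)))%:E.
Proof.
transitivity (\int[P]_w \int[mu]_v layer (w, v)).
  by apply: eq_integral => w _; exact: sum_largestE.
transitivity (\int[mu]_v \int[P]_w layer (w, v)).
  exact: (fubini_tonelli layer measurable_layer layer_ge0).
apply: eq_integral => v _; rewrite /layer /=.
rewrite !indicE mem_setE in_itv/= andbT; case: ltP => v0 /=; last first.
  rewrite mul0r; under eq_integral do rewrite mul0r.
  by rewrite integral0.
rewrite mul1r; under eq_integral do rewrite mul1r.
by apply: expectation_minn => // m; exact: fX.
Qed.

End largest_expectation.

Section normalized_expectation.
Local Open Scope ereal_scope.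
Context d (T : measurableType d) (R : realType) (P : probability T R).
Notation mu := (@lebesgue_measure R).
Variables (X : nat -> T -> R) (L l : nat) (a : nat -> R).
Hypothesis L0 : (0 < L)%N.
Hypothesis indX : mutually_independent P X.
Hypothesis X0 : forall m w, (0 <= X m w)%R.
Hypothesis lawX : forall m v, (0 < v)%R -> P [set w | (v <= X m w)%R] = (erlang_tail L v)%:E.
Hypothesis a_quantile : forall n, (1 < n)%N ->
  (0 < a n)%R /\ (erlang_tail L (a n) = n%:R^-1)%R.

(** The middle term is E[min(l, N)] for the number N of exceedances of [t], hence lies between 0 and
    E[N]. This supplies the bounds assumed in the dominated convergence. *)
Lemma truncated_count_bounds (n : nat) (t : R) : (l <= n)%N -> (0 < t)%R ->
  (0 <= l%:R - binomial_defect l n (erlang_tail L t) <= n%:R * erlang_tail L t)%R.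
Proof.
move=> ln t0; have pX m := lawX m t0; apply/andP; split.
  rewrite -lee_fin -(expectation_minn indX pX ln).
  by apply: integral_ge0 => w _; rewrite lee_fin.
exact: (minn_defect_le indX pX ln).
Qed.

Lemma integral_shifted_excess n : (1 < n)%N -> (l <= n)%N ->
  \int[mu]_v (\1_`]0%R, +oo[ v * (l%:R - binomial_defect l n (erlang_tail L v)))%:E =
  (b_of L (a n))%:E * \int[mu]_u (rescaled_excess L l a n u)%:E + (l%:R * a n)%:E.
Proof.
move=> n1 ln; have [a0 _] := a_quantile n1.
set b := b_of L (a n).
have b0 : (0 < b)%R by apply: lt_le_trans ltr01 _; apply: b_of_ge1 => //; exact: ltW.
pose h v : \bar R := (\1_`]0%R, +oo[ v * (l%:R - binomial_defect l n (erlang_tail L v)))%:E.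
have mh : measurable_fun setT h.
  apply/measurable_EFinP; apply: measurable_funM => //.
  apply: measurable_funB => //.
  apply: (measurableT_comp (@measurable_binomial_defect R l n)).
  exact: continuous_measurable_fun (@continuous_erlang_tail R L).
have h0 v : 0 <= h v.
  rewrite lee_fin indicE mem_setE in_itv/= andbT; case: ltP => v0; last by rewrite mul0r.
  by rewrite mul1r; have /andP[] := truncated_count_bounds ln v0.
have -> : \int[mu]_v h v = b%:E * \int[mu]_u h (a n + b * u)%R.
  exact: ge0_integral_affine.
pose D : set R := `]- (a n / b), 0]%classic%R.
have DE u : (\1_D u : R)%R = ((0 < a n + b * u)%R && (u <= 0)%R)%:R.
  rewrite indicE mem_setE in_itv/=; congr (_ && _)%:R.
  by rewrite -mulNr ltr_pdivrMr// [(u * b)%R]mulrC -subr_gt0 opprK addrC.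
have iD : \int[mu]_u (\1_D u)%:E = (a n / b)%:E.
  transitivity (mu D); first by apply: integral_indicT; exact: measurable_itv.
  rewrite lebesgue_measure_itv/= lte_fin oppr_lt0 divr_gt0//.
  by rewrite -EFinD opprK add0r.
have iD' : mu.-integrable setT (fun u => (\1_D u)%:E).
  apply/integrableP; split.
    apply/measurable_EFinP; apply: measurable_indic; exact: measurable_itv.
  under eq_integral do rewrite gee0_abs ?lee_fin//.
  by rewrite iD ltry.
transitivity (b%:E * \int[mu]_u ((rescaled_excess L l a n u)%:E + l%:R%:E * (\1_D u)%:E)).
  congr (_ * _); apply: eq_integral => u _.
  rewrite /h /rescaled_excess -/b -EFinM -EFinD DE; congr _%:E.
  rewrite !indicE !mem_setE !in_itv/= !andbT.
  by case: ltP => t0; case: ltP => u0 /=; ring.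
rewrite integralD//; last 2 first.
- exact: (@integrable_rescaled_excess R L L0 l a a_quantile truncated_count_bounds n n1 ln).
- exact: integrableZl.
have ir : \int[mu]_u (rescaled_excess L l a n u)%:E \is a fin_num.
  apply: integrable_fin_num => //.
  exact: (@integrable_rescaled_excess R L L0 l a a_quantile truncated_count_bounds n n1 ln).
rewrite integralZl// [X in _ * (_ + _ * X)]iD; move: ir.
case: (\int[mu]_u (rescaled_excess L l a n u)%:E) => [r _| |]//.
rewrite -[LHS]/((b * (r + l%:R * (a n / b)))%R%:E).
rewrite -[RHS]/((b * r + l%:R * a n)%R%:E).
by congr _%:E; rewrite mulrDr mulrCA (mulrCA b) mulfV ?gt_eqF// mulr1.
Qed.

(** The substitution in the level produces exactly the factor b_n and the shift l a_n, which the
    normalization removes; linearity is legitimate because the sum is integrable. *)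
Lemma expectation_normalized n : (1 < n)%N -> (l <= n)%N ->
  'E_P[fun w => ((sum_largest l [seq X m w | m <- iota 0 n] - l%:R * a n) / b_of L (a n))%R]
  = \int[mu]_u (rescaled_excess L l a n u)%:E.
Proof.
move=> n1 ln; have [a0 _] := a_quantile n1.
set b := b_of L (a n).
have b0 : (0 < b)%R by apply: lt_le_trans ltr01 _; apply: b_of_ge1 => //; exact: ltW.
pose S w := sum_largest l [seq X m w | m <- iota 0 n].
have mS : measurable_fun setT S by exact: (measurable_sum_largest _ _ indX X0).
have ir : \int[mu]_u (rescaled_excess L l a n u)%:E \is a fin_num.
  apply: integrable_fin_num => //.
  exact: (@integrable_rescaled_excess R L L0 l a a_quantile truncated_count_bounds n n1 ln).
have iS : \int[P]_w (S w)%:E =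
    b%:E * \int[mu]_u (rescaled_excess L l a n u)%:E + (l%:R * a n)%:E.
  by rewrite (expectation_sum_largest indX X0 lawX ln) integral_shifted_excess.
have S0 w : (0 <= S w)%R.
  rewrite /S /sum_largest big_seq; apply: sumr_ge0 => x /mem_take.
  by rewrite mem_sort => /mapP[m _ ->].
have intS : P.-integrable setT (fun w => (S w)%:E).
  apply/integrableP; split; first exact/measurable_EFinP.
  under eq_integral do rewrite gee0_abs ?lee_fin//.
  by rewrite iS -(fineK ir) -EFinM -EFinD ltry.
have intc : P.-integrable setT (fun w : T => (cst (l%:R * a n)%R w)%:E).
  exact: finite_measure_integrable_cst.
rewrite unlock /=.
transitivity (\int[P]_w (b^-1%:E * ((S w)%:E - (cst (l%:R * a n)%R w)%:E))).
  by apply: eq_integral => w _; rewrite -EFinB -EFinM mulrC.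
rewrite integralZl//; last exact: integrableB.
rewrite integralB//.
have -> : \int[P]_w (cst (l%:R * a n)%R w)%:E = (l%:R * a n)%:E.
  transitivity (\int[P]_w (cst (l%:R * a n)%:E w)); first exact: eq_integral.
  by rewrite integral_cst// -[RHS]mule1; congr (_ * _); exact: probability_setT.
rewrite [X in _ * (X - _)]iS; move: ir; case: (\int[mu]_u _) => [r _| |]//.
rewrite -[LHS]/((b^-1 * (b * r + l%:R * a n - l%:R * a n))%R%:E).
by rewrite addrK mulKf ?gt_eqF.
Qed.

End normalized_expectation.
(** The index of [G] is (copy, branch, real or imaginary part); standard deviation sqrt(1/2) for
    each part gives a complex Gaussian of unit variance. *)
Theorem theorem1 (R : realType) (d : measure_display) (T : measurableType d)
    (P : probability T R) (L : nat) (hL : (1 <= L)%N)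
    (G : nat * 'I_L * bool -> T -> R)
    (Gind : mutually_independent P G)
    (Gnorm : forall i, is_normal P 0 (Num.sqrt (2^-1)) (G i))
    (l : nat) (hl : (1 <= l)%N) :
  let X (m : nat) (w : T) : R :=
    \sum_(j < L) ((G (m, j, true) w) ^+ 2 + (G (m, j, false) w) ^+ 2) in
  let F (x : R) : R := fine (P [set w | X 0%N w <= x]) in
  let a (n : nat) : R := a_seq F n in
  let b (n : nat) : R := b_of L (a n) in
  ((fun n : nat =>
      ('E_P[fun w => ((sum_largest l [seq X m w | m <- iota 0 n] - l%:R * a n) / b n)%R])%E)
   @ \oo -->
   (l%:R%:E * (gumbel_mean R + (1 - \sum_(1 <= k < l.+1) k%:R^-1)%:E))%E).
Proof.
move=> X F a b.
have L0 : (0 < L)%N := hL.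
have lawX m x : (0 < x)%R -> P [set w | (x <= X m w)%R] = (erlang_tail L x)%:E.
  by move=> x0; exact: (power_law Gind Gnorm m x0).
have indX : mutually_independent P X := power_independent Gind.
have mX m : measurable_fun setT (X m) by case: indX.
have X0 m w : (0 <= X m w)%R := power_ge0 G m w.
have mle x : measurable [set w | (X 0%N w <= x)%R].
  exact: measurable_set_ler.
have FE x : (0 < x)%R -> (1 - F x = erlang_tail L x)%R.
  (* [F] is the complement of the strict tail, while [lawX] gives the non-strict one. *)
  move=> x0; have h := pr_gt_of_ge (mX 0%N) (@continuous_erlang_tail R L) (lawX 0%N) x0.
  rewrite /F; have -> : [set w | (X 0%N w <= x)%R] = ~` [set w | (x < X 0%N w)%R].
    by apply/seteqP; split => w /=; rewrite leNgt => /negP.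
  by rewrite probability_setC ?h//= ?subKr//; exact: measurable_set_ltr.
have Fmon : {homo F : x y / (x <= y)%R}.
  move=> x y xy; apply: fine_le; rewrite ?fin_num_measure//.
  apply: le_measure; rewrite ?inE// => w /= h; exact: le_trans h xy.
have aq n : (1 < n)%N -> (0 < a n)%R /\ (erlang_tail L (a n) = n%:R^-1)%R.
  by move=> n1; exact: a_seq_quantile.
have lim := integral_rescaled_excess_cvg L0 aq (truncated_count_bounds indX lawX (l := l)).
(* The limit integral is evaluated in the form l = m + 1. *)
case: l hl lim => // m _ lim.
rewrite -integral_limit_excess; apply: cvg_trans lim; apply: near_eq_cvg; near=> n.
apply/esym; apply: (expectation_normalized (P := P)) => //.
  by near: n; exact: nbhs_infty_gt.
by near: n; exact: nbhs_infty_ge.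
Unshelve. all: by end_near. Qed.
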